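(* Let $p$ be a prime number and $n$ a positive integer. Every Kakeya set $K \subseteq \mathbb{Q}_p^n$ has Hausdorff dimension $n$ and Minkowski dimension $n$.
   Context: $\mathbb{Q}_p$ denotes the field of $p$-adic numbers with norm $|x|_p = p^{-v_p(x)}$, and $\mathbb{Z}_p = \{z \in \mathbb{Q}_p : |z|_p \leq 1\}$ the $p$-adic integers. The space $\mathbb{Q}_p^n$ is equipped with the maximum norm $|(x_1,\ldots,x_n)|_p = \max_{1\leq i\leq n} |x_i|_p$; boundedness, Hausdorff dimension and Minkowski (box-counting) dimension are with respect to the metric induced by this norm. A Kakeya set in $\mathbb{Q}_p^n$ is a bounded subset $K \subseteq \mathbb{Q}_p^n$ containing a line segment of unit length in every direction: for every $x \in \mathbb{Z}_p^n$ (equivalently, for every $x \in \mathbb{Z}_p^n$ with $|x|_p = 1$) there is $b_x \in \mathbb{Q}_p^n$ such that $b_x + \lambda x \in K$ for all $\lambda \in \mathbb{Z}_p$. *)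

(* Defs.v *)
From HB Require Import structures.
From mathcomp Require Import all_boot all_order all_algebra.
From mathcomp Require Import all_classical all_reals all_analysis.
From mathcomp Require Import zify ring lra.
Set Implicit Arguments.
Unset Strict Implicit.
Unset Printing Implicit Defensive.
Import Order.TTheory GRing.Theory Num.Theory.
Import numFieldNormedType.Exports.
Local Open Scope classical_set_scope.
Local Open Scope ring_scope.

(* An element of lim Z/p^k is the sequence of its residues modulo p ^ k, each
   represented in [0, p ^ k): the coherence condition also forces reducedness.
   The primality proof indexes the type so that the ring instances, which
   need it, can be inferred. *)
Record padic_int (p : nat) (p_prime : prime p) := PadicInt {
  residue :> nat -> int;
  residueP : forall k, residue k = (residue k.+1 %% p%:Z ^+ k)%Z }.

Section PadicInt.
Variables (p : nat) (p_prime : prime p).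
Local Notation Zp := (padic_int p_prime).
Local Notation tofrac := (@FracField.tofrac (padic_int p_prime)).
Local Notation q k := (p%:Z ^+ k).

HB.instance Definition _ := gen_eqMixin Zp.
HB.instance Definition _ := gen_choiceMixin Zp.

Lemma padic_int_ext (x y : Zp) : (forall k, x k = y k) -> x = y.
Proof.
case: x y => [x hx] [y hy] /= /funext e; rewrite e in hx *.
by congr PadicInt; exact: Prop_irrelevance.
Qed.

Lemma modz_exp_le (a : int) k m : (k <= m)%N ->
  ((a %% q m)%Z %% q k)%Z = (a %% q k)%Z.
Proof.
move=> km; apply/eqP; rewrite eqz_mod_dvd; apply: (dvdz_trans (dvdz_exp2l _ km)).
by rewrite -eqz_mod_dvd modz_mod.
Qed.

Lemma residue_le (x : Zp) k m : (k <= m)%N -> x k = (x m %% q k)%Z.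
Proof.
move=> km; rewrite -(subnK km); elim: (m - k)%N => [|d ih].
  by rewrite add0n {2}residueP modz_mod -residueP.
by rewrite addSn ih (residueP x (d + k)%N) modz_exp_le// leq_addl.
Qed.

Lemma residue_mod (x : Zp) k : (x k %% q k)%Z = x k.
Proof. by rewrite -residue_le. Qed.

Lemma reduceP (f : nat -> int) (hf : forall k, (f k.+1 = f k %[mod q k])%Z) k :
  (f k %% q k)%Z = ((f k.+1 %% q k.+1)%Z %% q k)%Z.
Proof. by rewrite modz_exp_le// hf. Qed.

Definition padic_reduce f hf : Zp := PadicInt p_prime (reduceP (f := f) hf).

Lemma cst_coherent (a : int) k : (a = a %[mod q k])%Z. Proof. by []. Qed.

Lemma opp_coherent (x : Zp) k : (- x k.+1 = - x k %[mod q k])%Z.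
Proof. by rewrite (residueP x k) modzNm. Qed.

Lemma add_coherent (x y : Zp) k :
  (x k.+1 + y k.+1 = x k + y k %[mod q k])%Z.
Proof. by rewrite (residueP x k) (residueP y k) modzDm. Qed.

Lemma mul_coherent (x y : Zp) k :
  (x k.+1 * y k.+1 = x k * y k %[mod q k])%Z.
Proof. by rewrite (residueP x k) (residueP y k) modzMm. Qed.

Definition padic_int_of (a : int) : Zp := padic_reduce (cst_coherent a).
Definition padic_int_opp (x : Zp) : Zp := padic_reduce (opp_coherent x).
Definition padic_int_add (x y : Zp) : Zp := padic_reduce (add_coherent x y).
Definition padic_int_mul (x y : Zp) : Zp := padic_reduce (mul_coherent x y).

Lemma padic_int_addA : associative padic_int_add.
Proof. by move=> x y z; apply: padic_int_ext => k/=; rewrite modzDml modzDmr addrA. Qed.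

Lemma padic_int_addC : commutative padic_int_add.
Proof. by move=> x y; apply: padic_int_ext => k/=; rewrite addrC. Qed.

Lemma padic_int_add0 : left_id (padic_int_of 0) padic_int_add.
Proof. by move=> x; apply: padic_int_ext => k/=; rewrite mod0z add0r residue_mod. Qed.

Lemma padic_int_addN : left_inverse (padic_int_of 0) padic_int_opp padic_int_add.
Proof. by move=> x; apply: padic_int_ext => k/=; rewrite modzDml addNr. Qed.

HB.instance Definition _ := GRing.isZmodule.Build Zp
  padic_int_addA padic_int_addC padic_int_add0 padic_int_addN.

Lemma padic_int_mulA : associative padic_int_mul.
Proof. by move=> x y z; apply: padic_int_ext => k/=; rewrite modzMml modzMmr mulrA. Qed.

Lemma padic_int_mulC : commutative padic_int_mul.
Proof. by move=> x y; apply: padic_int_ext => k/=; rewrite mulrC. Qed.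

Lemma padic_int_mul1 : left_id (padic_int_of 1) padic_int_mul.
Proof. by move=> x; apply: padic_int_ext => k/=; rewrite modzMml mul1r residue_mod. Qed.

Lemma padic_int_mulDl : left_distributive padic_int_mul padic_int_add.
Proof.
by move=> x y z; apply: padic_int_ext => k/=; rewrite modzMml modzDm mulrDl.
Qed.

Lemma padic_int_1neq0 : padic_int_of 1 != 0.
Proof.
apply/eqP => /(congr1 (fun x : Zp => x 1%N))/=.
by rewrite mod0z modz_small// expr1 ltz_nat prime_gt1.
Qed.

HB.instance Definition _ := GRing.Zmodule_isComNzRing.Build Zp
  padic_int_mulA padic_int_mulC padic_int_mul1 padic_int_mulDl padic_int_1neq0.

Definition padic_int_unit : {pred Zp} := fun x => `[< exists y, y * x = 1 >].

Definition padic_int_inv (x : Zp) : Zp :=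
  if pselect (exists y, y * x = 1) is left e then projT1 (cid e) else x.

Lemma padic_int_mulV : {in padic_int_unit, left_inverse 1 padic_int_inv *%R}.
Proof.
move=> x /asboolP ux; rewrite /padic_int_inv; case: pselect => // e.
by case: (cid e).
Qed.

Lemma padic_int_unitP (x y : Zp) : y * x = 1 -> padic_int_unit x.
Proof. by move=> yx; apply/asboolP; exists y. Qed.

Lemma padic_int_inv_out : {in [predC padic_int_unit], padic_int_inv =1 id}.
Proof.
by move=> x /asboolP nux; rewrite /padic_int_inv; case: pselect.
Qed.

HB.instance Definition _ := GRing.ComNzRing_hasMulInverse.Build Zp
  padic_int_mulV padic_int_unitP padic_int_inv_out.

(* The largest k with x in p ^ k Z_p, that is, with x k = 0 (0 if x = 0). *)
Definition padic_int_val (x : Zp) : nat :=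
  if pselect (exists k, x k.+1 != 0) is left e then ex_minn e else 0%N.

Lemma residue0 (x : Zp) : x 0%N = 0.
Proof. by rewrite residueP expr0 modz1. Qed.

Lemma padic_int_valP (x : Zp) k : x != 0 -> (k <= padic_int_val x)%N = (x k == 0).
Proof.
move=> x0; rewrite /padic_int_val; case: pselect => [e|ne]; last first.
  exfalso; move/eqP: x0; apply; apply: padic_int_ext => -[|j].
    by rewrite !residue0.
  rewrite /= mod0z; apply/eqP; apply: contra_notT ne => ?; by exists j.
case: ex_minnP => v xv vmin; apply/idP/eqP.
  case: k => [|k kv]; first by rewrite residue0.
  by apply/eqP; apply: contraTT kv => /vmin; rewrite -leqNgt.
move=> xk; rewrite leqNgt; apply: contra xv => vk.
by rewrite (residue_le x vk) xk mod0z.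
Qed.

Lemma residue_eq0 (x : Zp) k m : (k <= m)%N -> (x k == 0) = (q k %| x m)%Z.
Proof. by move=> km; rewrite (residue_le x km); apply/eqP/dvdz_mod0P. Qed.

Lemma padic_int_dvd (x : Zp) m : x != 0 -> (padic_int_val x < m)%N ->
  exists2 a, x m = a * q (padic_int_val x) & ~~ (p%:Z %| a)%Z.
Proof.
move=> x0 vm; have := leqnn (padic_int_val x).
rewrite padic_int_valP// (residue_eq0 x (ltnW vm)) => /dvdzP[a xa]; exists a => //.
apply/negP => /dvdzP[b ab].
have : (padic_int_val x < padic_int_val x)%N.
  rewrite padic_int_valP// (residue_eq0 x vm) xa ab.
  by apply/dvdzP; exists b; rewrite exprS mulrA.
by rewrite ltnn.
Qed.

Lemma q_neq0 k : q k != 0 :> int.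
Proof. by rewrite expf_neq0// eqz_nat -lt0n prime_gt0. Qed.

Lemma padic_int_mul_residue (x y : Zp) : x != 0 -> y != 0 ->
  let v := (padic_int_val x + padic_int_val y)%N in
  (x * y) v = 0 /\ (x * y) v.+1 <> 0.
Proof.
move=> x0 y0 v.
have [|a xa na] := @padic_int_dvd x v.+1 x0; first by rewrite ltnS leq_addr.
have [|b yb nb] := @padic_int_dvd y v.+1 y0; first by rewrite ltnS leq_addl.
have e : (x v.+1 * y v.+1) = a * b * q v.
  by rewrite xa yb mulrACA -exprD.
have e1 : (x * y) v.+1 = (a * b * q v %% q v.+1)%Z by rewrite -e.
split.
  apply/eqP; rewrite (residue_eq0 _ (leqnSn v)) e1; apply/dvdz_mod0P.
  by rewrite modz_exp_le// modzMl.
rewrite e1 => /dvdz_mod0P/dvdzP[c]; rewrite exprS mulrA.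
move/(mulIf (q_neq0 v)) => abc.
suff : (p%:Z %| a * b)%Z.
  rewrite dvdzE abszM /= Euclid_dvdM//.
  by move: na nb; rewrite !dvdzE/= => /negbTE-> /negbTE->.
by rewrite abc; apply/dvdzP; exists c.
Qed.

Lemma padic_int_domain (x y : Zp) : x * y = 0 -> (x == 0) || (y == 0).
Proof.
move=> xy; apply: contraT; rewrite negb_or => /andP[x0 y0].
by have [_] := padic_int_mul_residue x0 y0; rewrite xy /= mod0z.
Qed.

HB.instance Definition _ := GRing.ComUnitRing_isIntegral.Build Zp padic_int_domain.

Lemma padic_int_valM (x y : Zp) : x != 0 -> y != 0 ->
  padic_int_val (x * y) = (padic_int_val x + padic_int_val y)%N.
Proof.
move=> x0 y0; have [xy0 xy1] := padic_int_mul_residue x0 y0.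
have xyn : x * y != 0 by rewrite mulf_neq0.
apply/eqP; rewrite eqn_leq; apply/andP; split; last by rewrite padic_int_valP// xy0.
rewrite leqNgt padic_int_valP//; exact/eqP.
Qed.

Lemma padic_int_valD (x y : Zp) : x != 0 -> y != 0 -> x + y != 0 ->
  (minn (padic_int_val x) (padic_int_val y) <= padic_int_val (x + y)%R)%N.
Proof.
move=> x0 y0 xy0; rewrite padic_int_valP//; set m := minn _ _.
have xm : x m = 0 by apply/eqP; rewrite -padic_int_valP// geq_minl.
have ym : y m = 0 by apply/eqP; rewrite -padic_int_valP// geq_minr.
by rewrite /= xm ym addr0 mod0z.
Qed.

Lemma padic_int_valN (x : Zp) : padic_int_val (- x) = padic_int_val x.
Proof.
have [->|x0] := eqVneq x 0; first by rewrite oppr0.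
have h k : ((- x) k == 0) = (x k == 0).
  have -> : (- x) k = (- x k %% q k)%Z by [].
  have -> : ((- x k %% q k)%Z == 0) = (q k %| - x k)%Z by apply/eqP/dvdz_mod0P.
  by rewrite dvdzE abszN -dvdzE -residue_eq0.
have nx0 : - x != 0 by rewrite oppr_eq0.
by apply/eqP; rewrite eqn_leq; apply/andP; split;
  [rewrite padic_int_valP// -h -padic_int_valP|
   rewrite padic_int_valP// h -padic_int_valP].
Qed.

(* Q_p. The sets Z_p below are written as unit balls of padic_norm in Q_p. *)
Definition padic : Type := {fraction Zp}.
HB.instance Definition _ := GRing.Field.on padic.

(* v_p of a numerator minus v_p of a denominator. *)
Definition padic_val (x : padic) : int :=
  (padic_int_val (frac (repr (x : {fraction Zp}))).1)%:Z -
  (padic_int_val (frac (repr (x : {fraction Zp}))).2)%:Z.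

Lemma fraction_repr (x : {fraction Zp}) :
  x * tofrac (frac (repr x)).2 = tofrac (frac (repr x)).1.
Proof.
rewrite -[X in X * _]reprK; unlock FracField.tofrac; rewrite -[LHS]FracField.pi_mul.
apply/eqmodP; rewrite /= FracField.equivfE /FracField.mulf.
by rewrite !numden_Ratio ?mulf_neq0 ?oner_eq0 ?denom_ratioP// !mulr1 mulrC.
Qed.

Lemma numer_repr_neq0 (x : {fraction Zp}) : x != 0 -> (frac (repr x)).1 != 0.
Proof.
by move=> x0; rewrite -(tofrac_eq0 (frac (repr x)).1) -fraction_repr mulf_neq0// tofrac_eq0 denom_ratioP.
Qed.

Lemma padic_val_frac (a b : Zp) : a != 0 -> b != 0 ->
  padic_val (tofrac a / tofrac b : padic) =
  (padic_int_val a)%:Z - (padic_int_val b)%:Z.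
Proof.
move=> a0 b0; rewrite /padic_val; set x : {fraction Zp} := _ / _.
have x0 : x != 0 by rewrite mulf_neq0// ?invr_eq0 tofrac_eq0.
have n0 := numer_repr_neq0 x0; have d0 := denom_ratioP (repr x).
have : a * (frac (repr x)).2 = (frac (repr x)).1 * b.
  apply/eqP; rewrite -tofrac_eq !tofracM -fraction_repr mulrAC /x divfK//.
  by rewrite tofrac_eq0.
move/(congr1 padic_int_val); rewrite !padic_int_valM// => e.
apply/eqP; rewrite subr_eq addrAC eq_sym subr_eq -!PoszD eqz_nat.
by rewrite e.
Qed.

End PadicInt.

Section PadicNorm.
Variables (R : realType) (p : nat) (p_prime : prime p).
Local Notation Zp := (padic_int p_prime).
Local Notation tofrac := (@FracField.tofrac (padic_int p_prime)).
Local Notation Qp := (padic p_prime).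

Definition padic_norm (x : Qp) : R :=
  if x == 0 then 0 else p%:R ^ (- padic_val x).

Let p_gt0 : 0 < p%:R :> R.
Proof. by rewrite ltr0n prime_gt0. Qed.

Lemma padic_norm_ge0 x : 0 <= padic_norm x.
Proof. by rewrite /padic_norm; case: ifP => // _; rewrite exprz_ge0// ltW. Qed.

Lemma padic_norm0 : padic_norm 0 = 0.
Proof. by rewrite /padic_norm eqxx. Qed.

Lemma padic_norm_eq0 x : padic_norm x = 0 -> x = 0.
Proof.
rewrite /padic_norm; case: eqVneq => // _ /eqP.
by rewrite expfz_eq0 (gt_eqF p_gt0) andbF.
Qed.

Lemma padic_common_denom (x y : Qp) : exists a b c : Zp,
  [/\ c != 0, x = tofrac a / tofrac c & y = tofrac b / tofrac c].
Proof.
pose n z : Zp := (frac (repr (z : {fraction Zp}))).1.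
pose d z : Zp := (frac (repr (z : {fraction Zp}))).2.
have d0 z : d z != 0 by exact: denom_ratioP.
have td z : tofrac (d z) != 0 by rewrite tofrac_eq0.
exists (n x * d y), (n y * d x), (d x * d y); split; first by rewrite mulf_neq0.
  apply: (canRL (mulfK _)); first by rewrite tofrac_eq0 mulf_neq0.
  by rewrite !tofracM mulrA fraction_repr.
apply: (canRL (mulfK _)); first by rewrite tofrac_eq0 mulf_neq0.
by rewrite !tofracM mulrCA mulrC fraction_repr.
Qed.

Lemma padic_normN x : padic_norm (- x) = padic_norm x.
Proof.
have [->|x0] := eqVneq x 0; first by rewrite oppr0.
have [a [_ [c [c0 xa _]]]] := padic_common_denom x x.
have a0 : a != 0 by apply: contra_neq x0 => a0; rewrite xa a0 tofrac0 mul0r.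
rewrite /padic_norm oppr_eq0 (negbTE x0) xa -mulNr -tofracN !padic_val_frac//.
  by rewrite padic_int_valN.
by rewrite oppr_eq0.
Qed.

Lemma padic_normM x y : padic_norm (x * y) = padic_norm x * padic_norm y.
Proof.
have [->|x0] := eqVneq x 0; first by rewrite mul0r padic_norm0 mul0r.
have [->|y0] := eqVneq y 0; first by rewrite mulr0 padic_norm0 mulr0.
have [a [b [c [c0 xa yb]]]] := padic_common_denom x y.
have a0 : a != 0 by apply: contra_neq x0 => a0; rewrite xa a0 tofrac0 mul0r.
have b0 : b != 0 by apply: contra_neq y0 => b0; rewrite yb b0 tofrac0 mul0r.
rewrite /padic_norm mulf_eq0 (negbTE x0) (negbTE y0)/=.
have -> : x * y = tofrac (a * b) / tofrac (c * c).
  by rewrite xa yb !tofracM mulf_div.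
rewrite {1}xa {1}yb !padic_val_frac ?mulf_neq0// !padic_int_valM//.
rewrite -expfzDr ?gt_eqF//; congr (_ ^ _).
by rewrite !PoszD !opprB opprD !addrA; lia.
Qed.

Lemma padic_norm_ultra x y :
  padic_norm (x + y) <= Num.max (padic_norm x) (padic_norm y).
Proof.
have [->|x0] := eqVneq x 0; first by rewrite add0r le_max lexx orbT.
have [->|y0] := eqVneq y 0; first by rewrite addr0 le_max lexx.
have [->|xy0] := eqVneq (x + y) 0.
  by rewrite padic_norm0 le_max padic_norm_ge0.
have [a [b [c [c0 xa yb]]]] := padic_common_denom x y.
have a0 : a != 0 by apply: contra_neq x0 => a0; rewrite xa a0 tofrac0 mul0r.
have b0 : b != 0 by apply: contra_neq y0 => b0; rewrite yb b0 tofrac0 mul0r.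
have xyE : x + y = tofrac (a + b) / tofrac c by rewrite xa yb -mulrDl tofracD.
have ab0 : a + b != 0.
  by apply: contra_neq xy0 => ab0; rewrite xyE ab0 tofrac0 mul0r.
have p1 : 1 <= p%:R :> R by rewrite ler1n prime_gt0.
rewrite /padic_norm (negbTE x0) (negbTE y0) (negbTE xy0) xyE {1}xa {1}yb.
rewrite !padic_val_frac//.
have := padic_int_valD a0 b0 ab0; rewrite geq_min le_max => /orP[]h; apply/orP;
  [left|right]; apply: ler_weXz2l => //; lia.
Qed.

End PadicNorm.

(* R only serves to type the distances, so that the metric can be inferred. *)
Definition padic_space (R : realType) (p : nat) (p_prime : prime p) (n : nat) :
  Type := 'rV[padic p_prime]_n.

Section PadicSpace.
Variables (R : realType) (p : nat) (p_prime : prime p) (n : nat).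
Local Notation Qp := (padic p_prime).
Local Notation V := (padic_space R p_prime n).

HB.instance Definition _ := GRing.Lmodule.copy V 'rV[padic p_prime]_n.

Definition padic_vnorm (x : V) : R :=
  \big[Num.max/0]_(i < n) padic_norm R ((x : 'rV[Qp]_n) 0 i).

Definition padic_dist (x y : V) : R := padic_vnorm (x - y).

Lemma padic_dist_xx x : padic_dist x x = 0.
Proof.
rewrite /padic_dist subrr /padic_vnorm; elim/big_ind: _ => // [a b -> ->|i _].
  by rewrite maxxx.
by rewrite mxE padic_norm0.
Qed.

Lemma padic_vnorm_ge (x : V) i : padic_norm R ((x : 'rV[Qp]_n) 0 i) <= padic_vnorm x.
Proof. exact: le_bigmax. Qed.

Lemma padic_dist_eq0 x y : padic_dist x y = 0 -> x = y.
Proof.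
move=> xy; apply/eqP; rewrite -subr_eq0; apply/eqP/rowP => i.
rewrite [RHS]mxE; apply: (@padic_norm_eq0 R); apply/eqP.
by rewrite eq_le padic_norm_ge0 andbT -xy padic_vnorm_ge.
Qed.

Lemma padic_dist_sym x y : padic_dist x y = padic_dist y x.
Proof.
rewrite /padic_dist /padic_vnorm; apply: eq_bigr => i _.
by rewrite -padic_normN !mxE opprB.
Qed.

Lemma padic_dist_triangle y x z :
  padic_dist x z <= padic_dist x y + padic_dist y z.
Proof.
have vge0 (u : V) : 0 <= padic_vnorm u.
  by rewrite /padic_vnorm; elim/big_ind: _ => // [a b a0 b0|i _];
    rewrite ?le_max ?a0 ?padic_norm_ge0.
apply/bigmax_leP; split=> [|i _]; first by rewrite addr_ge0// vge0.
have -> : (x - z : 'rV[Qp]_n) 0 i = (x - y : 'rV[Qp]_n) 0 i + (y - z : 'rV[Qp]_n) 0 i.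
  by rewrite !mxE addrA subrK.
apply: le_trans (padic_norm_ultra _ _ _) _.
have h1 := padic_vnorm_ge (x - y : V) i; have h2 := padic_vnorm_ge (y - z : V) i.
rewrite ge_max; apply/andP; split.
  by apply: le_trans h1 _; rewrite lerDl vge0.
by apply: le_trans h2 _; rewrite lerDr vge0.
Qed.

HB.instance Definition _ := isMetric.Build R V
  padic_dist_xx padic_dist_eq0 padic_dist_sym padic_dist_triangle.

(* The second clause quantifies over x in Z_p^n and l in Z_p. *)
Definition kakeya_set (K : set V) : Prop :=
  (exists M : R, forall x, K x -> padic_vnorm x <= M) /\
  (forall x : V, (forall i, padic_norm R ((x : 'rV[Qp]_n) 0 i) <= 1) ->
     exists b : V, forall l : Qp, padic_norm R l <= 1 -> K (b + l *: x)).

End PadicSpace.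

Section Dimension.
Local Open Scope ereal_scope.
Context {R : realType} {T : metricType R}.
Implicit Types (A U : set T) (s delta eps d : R).

Definition diameter A : \bar R :=
  ereal_sup (0 |` [set (mdist x y)%:E | x in A & y in A]).

(* (diam U)^s, with the conventions 0^0 = 1 on nonempty sets and 0 on set0. *)
Definition diameter_pow s U : \bar R :=
  if U == set0 then 0 else diameter U `^ s.

Definition hausdorff_premeasure delta s A : \bar R :=
  ereal_inf [set \sum_(i <oo) diameter_pow s (U i) | U in
    [set U : nat -> set T |
      A `<=` \bigcup_i U i /\ forall i, diameter (U i) <= delta%:E]].

Definition hausdorff_measure s A : \bar R :=
  ereal_sup [set hausdorff_premeasure delta s A | delta in [set d | (0 < d)%R]].

Definition hausdorff_dim A : \bar R :=
  ereal_inf [set s%:E | s in [set s | (0 <= s)%R /\ hausdorff_measure s A = 0]].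

(* Least number of closed balls of radius eps covering A (+oo if none do). *)
Definition covering_number eps A : \bar R :=
  ereal_inf [set (k%:R)%:E | k in
    [set k | exists c : 'I_k -> T,
      forall x, A x -> exists i, (mdist (c i) x <= eps)%R]].

(* lim log N(eps) / log (1 / eps) exists and equals d: both the lower and the
   upper Minkowski dimension are d. *)
Definition has_minkowski_dim A d : Prop :=
  lne (covering_number eps A) * ((ln eps^-1)^-1)%:E @[eps --> (0%R : R)^'+] --> d%:E.

End Dimension.

(* Main.v *)
Require Import Defs.
From mathcomp Require Import all_boot all_order all_algebra all_field.
From mathcomp Require Import all_classical all_reals all_analysis.
From mathcomp Require Import zify ring lra.
Set Implicit Arguments.
Unset Strict Implicit.
Unset Printing Implicit Defensive.
Import Order.TTheory GRing.Theory Num.Theory.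
Import numFieldNormedType.Exports.
Local Open Scope ring_scope.

(** The lower bounds rest on the polynomial method over roots of unity, which
turns lines of residues into geometric progressions.

Let q = p ^ k, let z be a primitive q-th root of unity, and send a vector s of
residues modulo q to the point with coordinates z ^ s_i.  Restricted to the
line a + l x, a polynomial P becomes the one-variable polynomial
Q_x(Y) = P(z ^ a_i Y ^ x_i), evaluated at Y = z ^ l.  If S has fewer than d ^ n
elements, some nonzero P of degree less than d in each variable vanishes on S;
then Q_x is divisible by the product of the Y - z ^ l over the l such that
a + l x is in S.  This product is monic over Z[z], so the divisibility survives
the reduction modulo 1 - z, which sends z to 1: over F_p, the polynomial
P(Y ^ x_1, ..., Y ^ x_n) has the root 1 with multiplicity at least the number of
these l.  But a Schwartz-Zippel argument ([sum_tmult_dot]) bounds the average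
over x of this multiplicity, truncated at q, by n d (k + 1), because
Y ^ b - Y ^ b' only has multiplicity p ^ v, with v the valuation of b - b'.
Hence [finite_kakeya]: if many directions x have a line meeting S in many
points, S has q ^ n elements up to a factor polynomial in k.  The reduction
needs a P that is integral and nonzero modulo 1 - z; [row_free_transfer] avoids
this normalization by arguing on minors of a matrix over Z[X], which specializes
to both X = z and X = 1.

A loss polynomial in k is harmless, even for covers that mix scales.  Given a cover
of a Kakeya set K by small sets, let S m collect the residues modulo p ^ m of
the members of size about p ^ - m.  Every point of K has a residue in some S m.
The weights 1 / ((m + 1) (m + 2)) have sum 1, so compactness ([exists_branch])
yields, for each direction, a level m at which a proportion at least
1 / ((m + 1) (m + 2)) of the parameters of its line land in S m; compactness
again, now for directions, yields a single level m that suits the same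
proportion of directions.  At this level, S m has at least C p ^ (m s) elements,
for any fixed s < n and C, as soon as the cover is fine enough
([kakeya_cover_level]).  This bounds from below both the sums that define the
Hausdorff measure in dimension s and the covering numbers.

The upper bounds only use that K is bounded: it lies in p ^ ((M + m) n) balls of
radius p ^ - m, for some constant M ([kakeya_bounded_cover]). *)

(** * Truncated multiplicity of the root 1 *)

Section TruncatedMultiplicity.
Variables (F : fieldType) (H : nat).
Implicit Types f g : {poly F}.

(** Truncating at [H] makes the multiplicity meaningful for the zero
polynomial, which has every multiplicity. *)
Definition tmult f : nat := if f == 0 then H else minn H (mup 1 f).

Lemma tmult_leH f : (tmult f <= H)%N.
Proof. by rewrite /tmult; case: ifP => // _; exact: geq_minl. Qed.

Lemma tmult_geq f h : (h <= H)%N -> (h <= tmult f)%N = (('X - 1) ^+ h %| f).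
Proof.
move=> hH; rewrite /tmult; case: eqVneq => [->|f0]; first by rewrite hH dvdp0.
by rewrite leq_min hH /= mup_geq.
Qed.

Lemma tmult_le_mup f : f != 0 -> (tmult f <= mup 1 f)%N.
Proof. by rewrite /tmult => /negbTE ->; exact: geq_minr. Qed.

Lemma tmultM f g : (tmult (f * g) <= tmult f + tmult g)%N.
Proof.
have [->|f0] := eqVneq f 0.
  by rewrite mul0r /tmult eqxx leq_addr.
have [->|g0] := eqVneq g 0.
  by rewrite mulr0 /tmult eqxx leq_addl.
by rewrite /tmult mulf_eq0 (negbTE f0) (negbTE g0) /= mupM//; lia.
Qed.

Lemma tmultB f g : (tmult f <= tmult g)%N -> (tmult f <= tmult (f - g))%N.
Proof.
move=> fg; rewrite tmult_geq ?tmult_leH//; apply: dvdp_sub.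
  by rewrite -tmult_geq ?tmult_leH.
by rewrite -tmult_geq ?tmult_leH.
Qed.

Lemma tmultN f : tmult (- f) = tmult f.
Proof.
have le g : (tmult g <= tmult (- g))%N.
  by rewrite tmult_geq ?tmult_leH// dvdpNr -tmult_geq ?tmult_leH.
by apply/eqP; rewrite eqn_leq le -{2}[f]opprK le.
Qed.

Lemma tmult_nonroot f : ~~ root f 1 -> tmult f = 0%N.
Proof.
move=> f1; have f0 : f != 0 by apply: contraNneq f1 => ->; rewrite root0.
by apply/eqP; rewrite -leqn0 -(mupNroot f1) tmult_le_mup.
Qed.

End TruncatedMultiplicity.

(** * Vanishing of polynomials along powers of one variable *)

Lemma sum_congr_ord N r c : (0 < N)%N ->
  (\sum_(b < N * r) (b == c %[mod N]) = r)%N.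
Proof.
move=> N0; elim: r => [|r ih]; first by rewrite muln0 big_ord0.
rewrite mulnS big_split_ord /=.
have -> : (\sum_(i < N) (i == c %[mod N]) = 1)%N.
  rewrite (bigD1 (Ordinal (ltn_pmod c N0)))//= modn_mod eqxx big1// => i ic.
  apply/eqP; rewrite eqb0 (modn_small (ltn_ord i)); apply: contra ic => /eqP e.
  exact/eqP/val_inj.
rewrite add1n; congr _.+1; rewrite -[RHS]ih; apply: eq_bigr => i _.
by rewrite modnDl.
Qed.

Definition dot n N d (x : n.-tuple 'I_N) (j : n.-tuple 'I_d) : nat :=
  (\sum_(i < n) tnth x i * tnth j i)%N.

Lemma dot_cons n N d (a : 'I_N) (x : n.-tuple 'I_N) (b : 'I_d)
    (j : n.-tuple 'I_d) :
  dot [tuple of a :: x] [tuple of b :: j] = (a * b + dot x j)%N.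
Proof.
rewrite /dot big_ord_recl !tnth0; congr (_ + _)%N.
by apply: eq_bigr => i _; rewrite !tnthS.
Qed.

Lemma big_tuple_cons (T : finType) (A : Type) (idx : A)
    (op : Monoid.com_law idx) n (G : n.+1.-tuple T -> A) :
  \big[op/idx]_t G t =
  \big[op/idx]_(x : T) \big[op/idx]_(t : n.-tuple T) G [tuple of x :: t].
Proof.
rewrite pair_big /=.
rewrite (reindex (fun u : T * n.-tuple T => [tuple of u.1 :: u.2]))//=.
exists (fun t => (thead t, [tuple of behead t])) => [[x t] _|t _] /=.
  by rewrite theadE; congr (_, _); apply/val_inj.
by rewrite [t in RHS]tuple_eta.
Qed.

Section PrimePower.
Variables (F : fieldType) (p k : nat).
Hypothesis pF : p \in [pchar F].
Let p_prime : prime p := pcharf_prime pF.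
Let p_gt0 : (0 < p)%N := prime_gt0 p_prime.
Local Notation q := (p ^ k)%N.
Local Notation tm := (@tmult F q).

(** For [m = b - b'] of valuation [v < k], Frobenius gives
[X ^ m - 1 = (X ^ m' - 1) ^ (p ^ v)] with [m'] prime to [p], and 1 is a simple
root of [X ^ m' - 1]: the multiplicity is [p ^ v], which is one term of the sum.
For [v >= k] the term [l = k] equals the truncation.  The full sum is kept
because it is easily averaged over [b]. *)
Lemma tmult_subX b b' :
  (tm ('X^b - 'X^b')
     <= \sum_(l < k.+1) (b == b' %[mod p ^ l]) * p ^ l)%N.
Proof.
wlog bb : b b' / (b' <= b)%N.
  move=> w; have [/w//|/ltnW/w] := leqP b' b.
  rewrite -tmultN opprB => /leq_trans; apply.
  by apply: leq_sum => l _; rewrite eq_sym.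
set m := (b - b')%N; have eb : b = (b' + m)%N by rewrite subnKC.
have congm l : (b == b' %[mod p ^ l]) = (p ^ l %| m)%N.
  by rewrite eqn_mod_dvd.
have [mk|mk] := boolP (p ^ k %| m)%N.
  rewrite big_ord_recr /= congm mk mul1n.
  exact: leq_trans (tmult_leH _ _) (leq_addl _ _).
have m0 : (0 < m)%N by rewrite lt0n; apply: contraNneq mk => ->; rewrite dvdn0.
have vk : (logn p m < k)%N.
  by rewrite ltnNge; apply: contra mk => km; rewrite pfactor_dvdn.
set v := logn p m in vk *.
have [m' pm' em] := pfactor_coprime p_prime m0; rewrite -/v in em.
have -> : 'X^b - 'X^b' = 'X^b' * ('X^m - 1) :> {poly F}.
  by rewrite mulrBr mulr1 -exprD eb.
apply: leq_trans (tmultM _ _ _) _.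
rewrite tmult_nonroot; last by rewrite rootE hornerXn expr1n oner_neq0.
rewrite add0n.
pose g : {poly F} := \sum_(i < m') 'X^i.
have fE : 'X^m - 1 = g ^+ (p ^ v) * ('X - 1) ^+ (p ^ v) :> {poly F}.
  have pnat : [pchar {poly F}].-nat (p ^ v)%N.
    by rewrite pnatX pnatE// pchar_poly pF.
  rewrite -exprMn [g * _]mulrC -subrX1 em exprM exprDn_pchar// exprNn_pchar//.
  by rewrite expr1n.
have g1 : ~~ root (g ^+ (p ^ v)) 1.
  rewrite rootE horner_exp expf_eq0 negb_and orbC; apply/orP; left.
  rewrite /g horner_sum (eq_bigr (fun=> 1)) => [|i _]; last first.
    by rewrite hornerXn expr1n.
  rewrite sumr_const card_ord -(dvdn_pcharf pF).
  by rewrite -prime_coprime.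
have f0 : 'X^m - 1 != 0 :> {poly F}.
  by rewrite -size_poly_gt0 size_XnsubC.
apply: leq_trans (tmult_le_mup _ f0) _.
rewrite fE mupMr// mup_XsubCX eqxx.
rewrite (bigD1 (Ordinal (ltnW vk : v < k.+1)%N))//= congm pfactor_dvdnn mul1n.
exact: leq_addr.
Qed.

Lemma sum_tmult_subX b' : (\sum_(b < q) tm ('X^b - 'X^b') <= k.+1 * q)%N.
Proof.
apply: (@leq_trans
    (\sum_(b < q) \sum_(l < k.+1) (b == b' %[mod p ^ l]) * p ^ l)).
  by apply: leq_sum => b _; exact: tmult_subX.
rewrite exchange_big /= -[X in (_ <= X * _)%N]card_ord -sum_nat_const.
apply: leq_sum => l _; rewrite -big_distrl /=.
have lk : (l <= k)%N by rewrite -ltnS.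
have -> : q = (p ^ l * p ^ (k - l))%N by rewrite -expnD subnKC.
by rewrite sum_congr_ord ?expn_gt0 ?p_gt0// mulnC.
Qed.

(** A bound on the values of a polynomial at the points
[X ^ x] by its top coefficient.  Over an algebraic closure one would compare
each value with the product of the distances to the roots.  Here the point [x]
where the multiplicity is maximal plays the role of a nearest root: dividing
[Q - Q.[X ^ x]] by ['X - X ^ x] keeps the top coefficient and costs, at each
other point [y], at most the multiplicity of [X ^ y - X ^ x]. *)
Lemma sum_tmult_horner (Q : {poly {poly F}}) e : (size Q <= e.+1)%N ->
  (\sum_(x < q) tm Q.['X^x] <= q * tm Q`_e + e * (k.+1 * q))%N.
Proof.
elim: e Q => [|e ih] Q szQ.
  rewrite (size1_polyC szQ) coefC /= mul0n addn0.
  under eq_bigr do rewrite hornerC.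
  by rewrite sum_nat_const card_ord.
have q0 : (0 < q)%N by rewrite expn_gt0 p_gt0.
(* By maximality, subtracting [Q.['X^x]] lowers no multiplicity (tmultB). *)
pose x := [arg max_(y > Ordinal q0) tm Q.['X^y]].
have xmax (y : 'I_q) : (tm Q.['X^y] <= tm Q.['X^x])%N.
  by rewrite /x; case: arg_maxnP => // i _; exact.
have /factor_theorem[Q1 eQ] : root (Q - (Q.['X^x])%:P) 'X^x.
  by rewrite rootE !hornerE subrr.
have szQ1 : (size Q1 <= e.+1)%N.
  have [->|Q10] := eqVneq Q1 0; first by rewrite size_poly0.
  have : (size (Q - (Q.['X^x])%:P)%R <= e.+2)%N.
    rewrite (leq_trans (size_polyD _ _))// geq_max szQ size_polyN.
    by rewrite (leq_trans (size_polyC_leq1 _)).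
  by rewrite eQ size_Mmonic ?monicXsubC// size_XsubC addn2.
have cQ1 : Q1`_e = Q`_e.+1.
  have := congr1 (fun P : {poly {poly F}} => P`_e.+1) eQ.
  rewrite coefB coefC /= subr0 mulrBr coefB coefMX /= => ->.
  by rewrite coefMC (nth_default _ szQ1) mul0r subr0.
apply: (@leq_trans (\sum_(y < q) (tm ('X^y - 'X^x) + tm Q1.['X^y]))).
  apply: leq_sum => y _; apply: leq_trans (tmultB (xmax y)) _.
  have -> : Q.['X^y] - Q.['X^x] = ('X^y - 'X^x) * Q1.['X^y].
    have := congr1 (fun P : {poly {poly F}} => P.['X^y]) eQ.
    by rewrite !hornerE /= => ->; rewrite mulrC.
  exact: tmultM.
rewrite big_split /= -cQ1 mulSn addnCA.
by apply: leq_add; [exact: sum_tmult_subX|exact: ih].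
Qed.

(** Schwartz-Zippel for the curve points [(X ^ b_1, ..., X ^ b_n)],
by induction on [n]: the first coordinate is handled by [sum_tmult_horner], and
the coefficient of its highest power is a polynomial in the remaining ones. *)
Lemma sum_tmult_dot n d (c : n.-tuple 'I_d -> F) : (exists j, c j != 0) ->
  (\sum_(b : n.-tuple 'I_q) tm (\sum_j c j *: 'X^(dot b j))
     <= n * d * (k.+1 * q ^ n))%N.
Proof.
elim: n c => [|n ih] c [j0 cj0].
  rewrite !mul0n leqn0 sum_nat_eq0; apply/forall_inP => b _.
  apply/eqP/tmult_nonroot.
  rewrite rootE horner_sum (bigD1 j0)//= big1 => [|j]; last first.
    by rewrite (tuple0 j) (tuple0 j0) eqxx.
  by rewrite addr0 hornerZ hornerXn expr1n mulr1.
pose ex_top e := [exists j : n.-tuple 'I_d, c [tuple of e :: j] != 0].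
have top0 : ex_top (thead j0).
  by apply/existsP; exists [tuple of behead j0]; rewrite -tuple_eta.
(* The degree in the first variable. *)
pose e := [arg max_(e > thead j0 | ex_top e) (e : nat)].
have [etop emax] : ex_top e /\ forall e', ex_top e' -> (e' <= e)%N.
  by rewrite /e; case: arg_maxnP.
pose qe e' (b : n.-tuple 'I_q) : {poly F} :=
  \sum_(j : n.-tuple 'I_d) c [tuple of e' :: j] *: 'X^(dot b j).
pose Q b : {poly {poly F}} := \sum_(e' < d) (qe e' b)%:P * 'X^e'.
have coefQ b (e' : 'I_d) : (Q b)`_e' = qe e' b.
  rewrite coef_sum (bigD1 e')//= coefCM coefXn eqxx mulr1 big1 ?addr0// => i ie.
  by rewrite coefCM coefXn eq_sym val_eqE (negbTE ie) mulr0.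
have szQ b : (size (Q b) <= e.+1)%N.
  apply: (leq_trans (size_sum _ _ _)); apply/bigmax_leqP => i _.
  have [ie|ei] := leqP i e.
    apply: (leq_trans (size_polyMleq _ _)); rewrite size_polyXn addnS /=.
    have /leq_add := size_polyC_leq1 (qe i b); move=> /(_ _ _ (leqnn i)).
    by move=> /leq_trans; apply; rewrite add1n.
  suff -> : qe i b = 0 by rewrite mul0r size_poly0.
  rewrite /qe big1// => j _; have [->|cn0] := eqVneq (c [tuple of i :: j]) 0.
    by rewrite scale0r.
  by move: ei; rewrite ltnNge emax//; apply/existsP; exists j.
rewrite big_tuple_cons exchange_big /=.
have QE (b : n.-tuple 'I_q) (x : 'I_q) :
    \sum_j c j *: 'X^(dot [tuple of x :: b] j) = (Q b).['X^x].
  rewrite big_tuple_cons horner_sum; apply: eq_bigr => e' _.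
  rewrite !hornerE /qe big_distrl /=; apply: eq_bigr => j _.
  by rewrite dot_cons -scalerAl -exprM -exprD addnC.
under eq_bigr do under eq_bigr do rewrite QE.
apply: (@leq_trans
    (\sum_(b : n.-tuple 'I_q) (q * tm (Q b)`_e + e * (k.+1 * q)))).
  by apply: leq_sum => b _; exact: sum_tmult_horner.
rewrite big_split /= sum_nat_const card_tuple card_ord -big_distrr /=.
under eq_bigr do rewrite coefQ.
have /existsP etop' := etop.
have := ih (fun j => c [tuple of e :: j]) etop'; rewrite -/(qe e _) => le1.
have ed : (e <= d)%N by exact/ltnW/ltn_ord.
apply: (@leq_trans (q * (n * d * (k.+1 * q ^ n)) + q ^ n * (d * (k.+1 * q)))).
  by rewrite leq_add ?leq_mul// leq_pmul.
by rewrite expnS; nia.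
Qed.

End PrimePower.

(** * From roots of unity to characteristic p *)

(** The quotient and remainder by a monic polynomial are unique
over any ring, so they commute with ring morphisms. *)
Lemma map_rmodp_monic (A B : nzRingType) (f : {rmorphism A -> B})
    (g m : {poly A}) : m \is monic ->
  map_poly f (Pdiv.Ring.rmodp g m)
  = Pdiv.Ring.rmodp (map_poly f g) (map_poly f m).
Proof.
move=> mm; have fm : map_poly f m \is monic by exact: monic_map.
rewrite [in RHS](Pdiv.RingMonic.rdivp_eq mm g) rmorphD rmorphM /=.
rewrite Pdiv.RingMonic.rmodp_addl_mul_small//.
have -> : size (map_poly f m) = size m.
  by rewrite size_map_poly_id0// (monicP mm) rmorph1 oner_neq0.
apply: leq_ltn_trans (size_poly _ _) _.
by rewrite Pdiv.Ring.ltn_rmodp monic_neq0.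
Qed.

(** When [f] factors through the image of [g], ranks can only
drop from [g] to [f]: a maximal minor that [f] does not kill is not killed by
[g]. *)
Lemma row_free_transfer (A : comNzRingType) (E F : fieldType)
    (f : {rmorphism A -> F}) (g : {rmorphism A -> E}) m n (G : 'M[A]_(m, n)) :
  (forall x, g x = 0 -> f x = 0) ->
  row_free (map_mx f G) -> row_free (map_mx g G).
Proof.
move=> gf fG.
have full : row_full (map_mx f G^T).
  by rewrite /row_full -map_trmx mxrank_tr.
pose H := rowsub (fullrankfun full) G^T.
have : map_mx f H \in unitmx.
  by rewrite map_mxsub; exact: fullrowsub_unit.
rewrite unitmxE det_map_mx unitfE => fH.
have gH : map_mx g H \in unitmx.
  by rewrite unitmxE det_map_mx unitfE; apply: contra_neq fH => /gf.
apply: inj_row_free => v /(congr1 trmx).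
rewrite trmx_mul trmx0 map_trmx => Gv.
have : map_mx g H *m v^T = 0.
  by rewrite map_mxsub mul_rowsub_mx Gv; apply/matrixP => i j; rewrite !mxE.
move/(congr1 (mulmx (invmx (map_mx g H)))); rewrite mulKmx// mulmx0.
by move/(congr1 trmx); rewrite trmxK trmx0.
Qed.

Section RootsOfUnity.
Variables (p k : nat).
Hypothesis p_prime : prime p.
Local Notation q := (p ^ k)%N.
Let p_gt0 : (0 < p)%N := prime_gt0 p_prime.
Let q_gt0 : (0 < q)%N. Proof. by rewrite expn_gt0 p_gt0. Qed.

Lemma Aint_horner_int (g : {poly int}) (z : algC) : z \in Aint ->
  (map_poly intr g).[z] \in Aint.
Proof.
move=> zA; apply: rpred_horner => //; apply/polyOverP => i.
by rewrite coef_map Aint_int.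
Qed.

(** Frobenius modulo [p], lifted to the integers. *)
Lemma expr_1subX_modp : exists w : {poly int},
  (1 - 'X) ^+ q = 1 - 'X^q + p%:Z *: w.
Proof.
pose P : {poly int} := (1 - 'X) ^+ q - (1 - 'X^q).
have P0 : map_poly (intr : int -> 'F_p) P = 0.
  have pnat : [pchar {poly 'F_p}].-nat (p ^ k)%N.
    by rewrite pnatX pnatE// pchar_poly pchar_Fp.
  rewrite /P !rmorphB rmorphXn /= rmorphB /= rmorph1 map_polyX map_polyXn.
  by rewrite exprDn_pchar// exprNn_pchar// expr1n subrr.
exists (\poly_(i < size P) (P`_i %/ p)%Z).
suff -> : p%:Z *: \poly_(i < size P) (P`_i %/ p)%Z = P by rewrite /P [RHS]addrC subrK.
apply/polyP => i.
rewrite coefZ coef_poly; case: ifPn => [_|]; last first.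
  by rewrite -leqNgt mulr0 => /(nth_default 0) ->.
rewrite mulrC divzK// (dvdz_pcharf (pchar_Fp p_prime)).
by have /(congr1 (fun g : {poly 'F_p} => g`_i)) := P0; rewrite coef_map coef0 => ->.
Qed.

(** Modulo [1 - z] one has [g.[1] = g.[z] = 0], and [(1 - z) ^ q] is [p]
times an algebraic integer; so [g.[1] ^ q / p] is a rational algebraic
integer. *)
Lemma dvdz_horner1 (g : {poly int}) (z : algC) : z ^+ q = 1 ->
  (map_poly intr g).[z] = 0 -> (p %| g.[1])%Z.
Proof.
move=> zq gz.
have zA : z \in Aint.
  by apply: (@Aint_unity_root q); rewrite // unity_rootE zq.
have [w ew] := expr_1subX_modp.
have /factor_theorem[h eh] : root (g - g.[1]%:P) 1 by rewrite rootE !hornerE subrr.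
have e1 : (1 - z) ^+ q = p%:R * (map_poly intr w).[z].
  have := congr1 (fun P => (map_poly (intr : int -> algC) P).[z]) ew.
  rewrite rmorphXn !rmorphD !rmorphN /= map_polyZ rmorph1 map_polyX map_polyXn.
  by rewrite !hornerE zq subrr add0r.
have e2 : (g.[1])%:~R = (1 - z) * (map_poly intr h).[z].
  have := congr1 (fun P => (map_poly (intr : int -> algC) P).[z]) eh.
  rewrite rmorphM !rmorphB /= map_polyX !map_polyC !hornerE /= gz => e.
  by apply: oppr_inj; rewrite -sub0r e /=; ring.
have e3 : (g.[1] ^+ q)%:~R / p%:R
    = (map_poly intr w).[z] * (map_poly intr h).[z] ^+ q :> algC.
  rewrite rmorphXn /= e2 exprMn e1 [LHS]mulrC -mulrA mulKf//.
  by rewrite pnatr_eq0 -lt0n.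
have : (g.[1] ^+ q)%:~R / p%:R \in (Num.int : {pred algC}).
  apply: Cint_rat_Aint; first by rewrite rpred_div ?rpred_int ?rpred_nat.
  by rewrite e3 rpredM ?rpredX ?Aint_horner_int.
move=> /intrP[m em].
have e4 : g.[1] ^+ q = m * p%:Z.
  apply/eqP; rewrite -(eqr_int algC) rmorphM /= -em divfK//.
  by rewrite pnatr_eq0 -lt0n.
have : (p %| g.[1] ^+ q)%Z by rewrite e4 dvdz_mull.
by rewrite !dvdzE /= abszX Euclid_dvdX// => /andP[].
Qed.

End RootsOfUnity.

(** * Kakeya sets modulo a prime power *)

Definition on_line N n (a x : n.-tuple 'I_N) (l : nat) (s : n.-tuple 'I_N) :=
  [forall i, tnth s i == tnth a i + l * tnth x i %[mod N]].

Lemma dot_on_line N n d (a x s : n.-tuple 'I_N) l (j : n.-tuple 'I_d) :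
  on_line a x l s -> dot s j = dot a j + l * dot x j %[mod N].
Proof.
move=> /forallP sl; rewrite /dot big_distrr -big_split /=.
rewrite -modn_summ -[RHS]modn_summ; congr (_ %% _)%N; apply: eq_bigr => i _.
by rewrite -modnMml (eqP (sl i)) modnMml mulnDl mulnA.
Qed.

Definition line_params N n (S : {set n.-tuple 'I_N}) (a x : n.-tuple 'I_N) :=
  [set l : 'I_N | [exists s in S, on_line a x l s]].

Section FiniteKakeya.
Variables (p k n d : nat).
Hypothesis p_prime : prime p.
Local Notation q := (p ^ k)%N.
Local Notation point := (n.-tuple 'I_q).
Local Notation expo := (n.-tuple 'I_d).
Variables (S : {set point}) (a : point -> point).
Let p_gt0 : (0 < p)%N := prime_gt0 p_prime.
Let q_gt0 : (0 < q)%N. Proof. by rewrite expn_gt0 p_gt0. Qed.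

Local Notation params x := (line_params S (a x) x).

(** For [t] a primitive [q]-th root of unity its roots are simple, one for
each point of the line in [S]; for [t = 1] it is a power of ['X - 1]. *)
Definition params_poly (A : nzRingType) (t : A) (x : point) : {poly A} :=
  \prod_(l <- enum (params x)) ('X - (t ^+ l)%:P).

(** The polynomial with coefficients [c], restricted to the line
through [a x] with direction [x]: its value at [t ^ l] is the value of the
original polynomial at the powers of [t] given by the point of parameter
[l]. *)
Definition restricted_poly (A : comNzRingType) (t : A) (c : expo -> A) x :=
  \sum_j (c j * t ^+ dot (a x) j) *: 'X^(dot x j).

(** Row [j] lists, over all directions [x], the coefficients of the
remainder of the restricted monomial [j] by [params_poly].  Working over
[{poly int}] with [t = 'X] lets the same matrix specialize to a root of unity
in characteristic 0 and to 1 in characteristic [p]. *)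
Definition remainder_mx : 'M[{poly int}]_(#|{: expo}|, #|{: point * 'I_q}|) :=
  \matrix_(j, r)
    let: u := enum_val r : point * 'I_q in
    (Pdiv.Ring.rmodp (restricted_poly 'X (fun i => (i == enum_val j)%:R) u.1)
                     (params_poly 'X u.1))`_(u.2).

Lemma params_poly_monic (A : nzRingType) (t : A) x :
  params_poly t x \is monic.
Proof. exact: monic_prod_XsubC. Qed.

Lemma size_params_poly (A : nzRingType) (t : A) x :
  size (params_poly t x) = #|params x|.+1.
Proof. by rewrite size_prod_XsubC cardE. Qed.

Lemma size_rem_params (A : nzRingType) (t : A) x g :
  (size (Pdiv.Ring.rmodp g (params_poly t x)) <= q)%N.
Proof.
have := Pdiv.Ring.ltn_rmodpN0 g (monic_neq0 (params_poly_monic t x)).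
rewrite size_params_poly ltnS => /leq_trans; apply.
by rewrite -[X in (_ <= X)%N]card_ord max_card.
Qed.

Section Specialize.
Variables (E : fieldType) (f : {rmorphism {poly int} -> E}).
Local Notation t := (f 'X).

Lemma map_params_poly x : map_poly f (params_poly 'X x) = params_poly t x.
Proof.
rewrite /params_poly rmorph_prod; apply: eq_bigr => l _.
by rewrite rmorphB /= map_polyX map_polyC /= rmorphXn.
Qed.

Lemma mul_remainder_mxE (v : 'rV[E]_#|{: expo}|) x (i : 'I_q) :
  (v *m map_mx f remainder_mx) 0 (enum_rank (x, i)) =
  (Pdiv.Ring.rmodp (restricted_poly t (fun j => v 0 (enum_rank j)) x)
                   (params_poly t x))`_i.
Proof.
pose mono (j : expo) : {poly E} := (t ^+ dot (a x) j) *: 'X^(dot x j).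
have -> : restricted_poly t (fun j => v 0 (enum_rank j)) x
    = \sum_(j < #|{: expo}|) v 0 j *: mono (enum_val j).
  rewrite /restricted_poly (big_enum_val _) /=.
  by apply: eq_bigr => j _; rewrite enum_valK scalerA.
rewrite (Pdiv.RingMonic.rmodp_sum (params_poly_monic t x)) coef_sum mxE.
apply: eq_bigr => j _; rewrite !mxE enum_rankK.
rewrite (Pdiv.RingMonic.rmodpZ (params_poly_monic t x)) coefZ.
congr (_ * _); rewrite -coef_map /= map_rmodp_monic ?params_poly_monic//.
rewrite map_params_poly; congr (Pdiv.Ring.rmodp _ _)`_i.
rewrite /restricted_poly (bigD1 (enum_val j))//= eqxx mul1r big1 ?addr0.
  by rewrite linearZ /= map_polyXn rmorphXn.
by move=> j' /negbTE ->; rewrite mul0r scale0r.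
Qed.

(** This identifies the left kernel with a space of polynomials, the form
in which [finite_kakeya] studies it at both specializations. *)
Lemma remainder_mx_eq0 (v : 'rV[E]_#|{: expo}|) :
  v *m map_mx f remainder_mx = 0 <->
  forall x, params_poly t x %| restricted_poly t (fun j => v 0 (enum_rank j)) x.
Proof.
have dvdE (m g : {poly E}) : m \is monic -> (m %| g) = (Pdiv.Ring.rmodp g m == 0).
  by move=> mm; rewrite -(@Pdiv.IdomainMonic.modpE _ _ mm g).
split=> [v0 x|v0].
  rewrite dvdE ?params_poly_monic//; apply/eqP/polyP => i; rewrite coef0.
  have [iq|qi] := ltnP i q.
    by rewrite -(mul_remainder_mxE v x (Ordinal iq)) v0 mxE.
  by rewrite nth_default// (leq_trans (size_rem_params _ _ _)).
apply/rowP => r; rewrite -[r]enum_valK; case: (enum_val r) => x i.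
rewrite mul_remainder_mxE mxE; move: (v0 x).
by rewrite dvdE ?params_poly_monic// => /eqP ->; rewrite coef0.
Qed.

End Specialize.

(** At [t = 1] over [F_p], the left kernel of [remainder_mx] is
trivial, by [sum_tmult_dot] and the hypothesis.  Hence it is trivial at a
primitive root of unity.  There, however, any polynomial that vanishes on [S]
lies in the kernel, and one exists if [S] has fewer elements than there are
monomials. *)
Lemma finite_kakeya :
  (n * d * (k.+1 * q ^ n) < \sum_x #|params x|)%N -> (d ^ n <= #|S|)%N.
Proof.
move=> big_lines; rewrite leqNgt; apply/negP => smallS.
have cardJ : #|{: expo}| = (d ^ n)%N by rewrite card_tuple card_ord.
have [z prim_z] := C_prim_root_exists q_gt0.
pose f1 : {rmorphism {poly int} -> 'F_p} :=
  [the {rmorphism _ -> _} of (intr \o horner_eval (1 : int))].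
pose fz : {rmorphism {poly int} -> algC} :=
  [the {rmorphism _ -> _} of (horner_eval z \o map_poly intr)].
have f1X : f1 'X = 1 by rewrite /= /horner_eval hornerX.
have fzX : fz 'X = z by rewrite /= /horner_eval map_polyX hornerX.
have z_to_1 g : fz g = 0 -> f1 g = 0.
  rewrite /= /horner_eval => gz; apply/eqP.
  rewrite -(dvdz_pcharf (pchar_Fp p_prime)).
  exact: (dvdz_horner1 p_prime (prim_expr_order prim_z) gz).
have free1 : row_free (map_mx f1 remainder_mx).
  apply: inj_row_free => v /remainder_mx_eq0; rewrite f1X => v0.
  pose c (j : expo) := v 0 (enum_rank j).
  have [/eqfunP c0|/forallPn[j cj]] := boolP [forall j, c j == 0].
    by apply/rowP => i; rewrite mxE -[i]enum_valK -/(c _) c0.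
  have := sum_tmult_dot k (pchar_Fp p_prime) (ex_intro _ j cj).
  rewrite leqNgt => /negP[]; apply: (leq_trans big_lines).
  apply: leq_sum => x _.
  rewrite tmult_geq; last by rewrite -[X in (_ <= X)%N]card_ord max_card.
  have -> : \sum_j c j *: 'X^(dot x j) = restricted_poly 1 c x.
    by apply: eq_bigr => i _; rewrite expr1n mulr1.
  have <- : params_poly 1 x = ('X - 1) ^+ #|params x| :> {poly 'F_p}.
    rewrite /params_poly big_enum -prodr_const /=.
    by apply: eq_bigr => l _; rewrite expr1n.
  exact: v0.
have freez := row_free_transfer z_to_1 free1.
pose M : 'M[algC]_(#|{: expo}|, #|S|) :=
  \matrix_(j, s) z ^+ dot (enum_val s) (enum_val j).
(* [M] has fewer columns than rows: a left kernel vector is a polynomial that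
   vanishes on [S]. *)
have : ~~ row_free M.
  by rewrite /row_free neq_ltn (leq_ltn_trans (rank_leq_col _))// cardJ.
rewrite -kermx_eq0 => /rowV0Pn[v /sub_kermxP vM v_neq0].
have : v *m map_mx fz remainder_mx = 0.
  apply/remainder_mx_eq0 => x; rewrite fzX.
  set Q := restricted_poly _ _ _.
  have [||q' ->] := @uniq_roots_prod_XsubC _ Q
    [seq z ^+ (l : 'I_q) | l <- enum (params x)].
  - apply/allP => _ /mapP[l + ->]; rewrite mem_enum inE => /exists_inP[s sS].
    move=> sl; rewrite rootE horner_sum.
    have := congr1 (fun w : 'rV_ _ => w 0 (enum_rank_in sS s)) vM.
    rewrite !mxE => vs; apply/eqP; rewrite -[RHS]vs (big_enum_val _) /=.
    apply: eq_bigr => j _; rewrite hornerZ hornerXn enum_valK -mulrA; congr (_ * _).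
    rewrite mxE enum_rankK_in// -exprM -exprD.
    by apply/esym/eqP; rewrite (eq_prim_root_expr prim_z); apply/eqP/dot_on_line.
  - rewrite uniq_rootsE map_inj_uniq ?enum_uniq// => l l' /eqP.
    by rewrite (eq_prim_root_expr prim_z) !modn_small// => /eqP/val_inj.
  by rewrite big_map dvdp_mull.
move/eqP; rewrite mulmx_free_eq0// => /eqP v0.
by rewrite v0 eqxx in v_neq0.
Qed.

End FiniteKakeya.

(** * Branches of a tree avoiding sparse sets *)

Section Branches.
Variables (X : nat -> finType) (red : forall m, X m.+1 -> X m) (B : nat).
Variable E : forall m, {set X m}.
Hypothesis fiber_card : forall m (t : X m), (B <= #|[set u | red u == t]|)%N.
Hypothesis X0_gt0 : (0 < #|X 0|)%N.
Hypothesis B_gt0 : (0 < B)%N.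

Fixpoint survives N m (t : X m) : bool :=
  (t \notin E m) &&
  (if N is N'.+1 then [exists u, (red u == t) && survives N' u] else true).

Lemma survivesW N m (t : X m) : survives N.+1 t -> survives N t.
Proof.
elim: N m t => [|N ih] m t /andP[tE]; first by rewrite /= tE.
move=> /existsP[u /andP[ut uN]] /=; rewrite tE /=.
by apply/existsP; exists u; rewrite ut ih.
Qed.

Lemma survives_le N N' m (t : X m) : (N <= N')%N -> survives N' t -> survives N t.
Proof.
by move=> /subnK <-; elim: (N' - N)%N => // i ih /survivesW; rewrite -/addn; exact: ih.
Qed.

(** Koenig's lemma: otherwise each of the finitely many children
dies at some stage, and [t] dies right after the last of these. *)
Lemma survives_child m (t : X m) : (forall N, survives N t) ->
  exists u, red u = t /\ forall N, survives N u.
Proof.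
move=> st; apply: contrapT => /forallNP noc.
have /choice[h hP] (u : X m.+1) : exists N, red u = t -> ~~ survives N u.
  have [e|ne] := pselect (red u = t); last by exists 0%N.
  have /not_andP[//|/existsNP[N hN]] := noc u.
  by exists N => _; exact/negP.
have /andP[_ /existsP[u /andP[/eqP ut us]]] := st (\max_u h u).+1.
by move: (hP u ut); rewrite (survives_le _ us)// leq_bigmax.
Qed.

Definition dead N m : {set X m} := [set t | ~~ survives N t].

(** Distinct points have disjoint fibers, each of size at least [B]. *)
Lemma card_dead_children N m :
  (B * #|[set t : X m | [forall u, (red u == t) ==> (u \in dead N m.+1)]]|
     <= #|dead N m.+1|)%N.
Proof.
set Z := [set t | _].
rewrite mulnC -sum_nat_const -[X in (_ <= X)%N]sum1_card.
rewrite [X in (_ <= X)%N](partition_big (@red m) xpredT)//=.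
rewrite [X in (_ <= X)%N](bigID (mem Z))/=; apply: leq_trans (leq_addr _ _).
apply: leq_sum => t; rewrite inE => /forallP tZ.
apply: leq_trans (fiber_card t) _; rewrite sum1dep_card subset_leq_card//.
apply/fintype.subsetP => u; rewrite !inE => /eqP ut.
by have := tZ u; rewrite inE ut eqxx /= => ->.
Qed.

Hypothesis E_small : forall m, (#|E m| * (m.+1 * m.+2) <= B ^ m)%N.

(** The bound telescopes: [1 / ((m + 1) (m + 2))] is
[1 / (m + 1) - 1 / (m + 2)].  At level 0 it is less than 1, whatever [N]. *)
Lemma card_dead N m :
  (#|dead N m|%:R <= (B ^ m)%:R * (m.+1%:R^-1 - (m + N).+2%:R^-1) :> rat).
Proof.
have cE k : (#|E k|%:R <= (B ^ k)%:R * (k.+1%:R^-1 - k.+2%:R^-1) :> rat).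
  have -> : k.+1%:R^-1 - k.+2%:R^-1 = (k.+1 * k.+2)%:R^-1 :> rat.
    by rewrite natrM; field; rewrite !gt_eqF// ltr_pwDl ?ler0n.
  by rewrite ler_pdivlMr ?ltr0n// -natrM ler_nat E_small.
elim: N m => [|N ih] m.
  rewrite addn0; apply: le_trans (cE m); rewrite ler_nat subset_leq_card//.
  by apply/fintype.subsetP => t; rewrite inE /= andbT negbK.
pose Z := [set t : X m | [forall u, (red u == t) ==> (u \in dead N m.+1)]].
have dZ : (#|dead N.+1 m| <= #|E m| + #|Z|)%N.
  apply: leq_trans (leq_card_setU _ _); rewrite subset_leq_card//.
  apply/fintype.subsetP => t; rewrite !inE /= negb_and negbK => /orP[->//|nu].
  apply/orP; right; apply/forallP => u; apply/implyP => ut; rewrite inE.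
  by apply: contra nu => su; apply/existsP; exists u; rewrite ut.
have cZ : #|Z|%:R <= (B ^ m)%:R * (m.+2%:R^-1 - (m + N).+3%:R^-1) :> rat.
  have B0 : (0 : rat) < B%:R by rewrite ltr0n.
  rewrite -(ler_pM2l B0) mulrA -!natrM -expnS.
  apply: le_trans (_ : #|dead N m.+1|%:R <= _).
    by rewrite ler_nat card_dead_children.
  by have := ih m.+1; rewrite addSn.
apply: le_trans (_ : (#|E m| + #|Z|)%:R <= _); first by rewrite ler_nat.
rewrite natrD (le_trans (lerD (cE m) cZ))// -mulrDr addrA subrK.
by rewrite addnS.
Qed.

Lemma exists_survivor : exists t : X 0, forall N, survives N t.
Proof.
have /card_gt0P[t _] := X0_gt0.
exists t => N; apply: contraT => tN.
have : (1 <= #|dead N 0|)%N by apply/card_gt0P; exists t; rewrite inE.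
have := card_dead N 0; rewrite expn0 mul1r add0n invr1 => c1 c2.
suff : (#|dead N 0|%:R < 1%:R :> rat) by rewrite ltr_nat ltnNge c2.
by apply: le_lt_trans c1 _; rewrite gtrBl invr_gt0 ltr0n.
Qed.

(** The sets [E m], of densities at most [1 / ((m + 1) (m + 2))], do
not cover the inverse limit: compactness replaces here the countable
subadditivity of Haar measure. *)
Lemma exists_branch : exists x : forall m, X m,
  (forall m, red (x m.+1) = x m) /\ forall m, x m \notin E m.
Proof.
have [t0 t0P] := exists_survivor.
pose G m := {t : X m | forall N, survives N t}.
pose next m (t : G m) : G m.+1 :=
  let c := cid (survives_child (projT2 t)) in
  exist _ (projT1 c) (proj2 (projT2 c)).
pose y : forall m, G m := nat_rect G (exist _ t0 t0P) next.
exists (fun m => projT1 (y m)); split => m.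
  by rewrite /= /next; case: cid => u [].
by have /andP[] := projT2 (y m) 0%N.
Qed.

End Branches.

(** * Integral parts of p-adic numbers *)

Section IntegralPart.
Variables (R : realType) (p : nat) (p_prime : prime p).
Local Notation Zp := (padic_int p_prime).
Local Notation Qp := (padic p_prime).
Local Notation norm := (padic_norm R (p_prime := p_prime)).
Local Notation q k := (p%:Z ^+ k).

Definition of_Zp (z : Zp) : Qp := FracField.tofrac z.

Lemma of_ZpD z w : of_Zp (z + w) = of_Zp z + of_Zp w.
Proof. exact: tofracD. Qed.
Lemma of_ZpB z w : of_Zp (z - w) = of_Zp z - of_Zp w.
Proof. exact: tofracB. Qed.
Lemma of_ZpM z w : of_Zp (z * w) = of_Zp z * of_Zp w.
Proof. exact: tofracM. Qed.
Lemma of_Zp_inj : injective of_Zp.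
Proof. by move=> z w /eqP; rewrite /of_Zp tofrac_eq => /eqP. Qed.

Lemma residueD (z w : Zp) k : (z + w) k = ((z k + w k) %% q k)%Z.
Proof. by []. Qed.
Lemma residueN (z : Zp) k : (- z) k = (- z k %% q k)%Z.
Proof. by []. Qed.
Lemma residueM (z w : Zp) k : (z * w) k = ((z k * w k) %% q k)%Z.
Proof. by []. Qed.

Lemma residueB_eq0 (z w : Zp) k : ((z - w) k = 0) <-> z k = w k.
Proof.
rewrite residueD residueN modzDmr; split=> [/dvdz_mod0P|->]; last by rewrite subrr mod0z.
by rewrite -(eqz_mod_dvd) !residue_mod => /eqP.
Qed.

Let p_gt0 : 0 < p%:R :> R. Proof. by rewrite ltr0n prime_gt0. Qed.
Let p_gt1 : 1 < p%:R :> R. Proof. by rewrite ltr1n prime_gt1. Qed.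

Lemma norm_of_Zp z : z != 0 -> norm (of_Zp z) = p%:R ^- padic_int_val z.
Proof.
move=> z0.
have e : of_Zp z = FracField.tofrac z / FracField.tofrac (1 : Zp) :> {fraction Zp}.
  by rewrite tofrac1 divr1.
have n0 : of_Zp z != 0 by rewrite /of_Zp tofrac_eq0.
have v1 : padic_int_val (1 : Zp) = 0%N.
  apply/eqP; rewrite -leqn0 leqNgt padic_int_valP ?oner_neq0//=.
  by rewrite modz_small// expr1 ltz_nat prime_gt1.
by rewrite /padic_norm (negbTE n0) e padic_val_frac ?oner_neq0// v1 subr0 exprnN.
Qed.

Lemma norm_of_Zp_le z k : (norm (of_Zp z) <= p%:R ^- k) = (z k == 0).
Proof.
have [->|z0] := eqVneq z 0.
  by rewrite /of_Zp tofrac0 padic_norm0 invr_ge0 exprn_ge0 ?(ltW p_gt0)//= mod0z eqxx.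
by rewrite norm_of_Zp// lef_pV2 ?posrE ?exprn_gt0// ler_eXn2l// padic_int_valP.
Qed.

Lemma norm_of_Zp_expn M :
  norm (of_Zp (padic_int_of p_prime (p%:Z ^+ M))) = p%:R ^- M.
Proof.
set z := padic_int_of _ _.
have zk k : (z k == 0) = (k <= M)%N.
  have -> : (z k == 0) = (q k %| q M)%Z by apply/eqP/dvdz_mod0P.
  by rewrite dvdzE !abszX dvdn_Pexp2l// prime_gt1.
have z0 : z != 0.
  by apply/eqP => z0; have := zk M.+1; rewrite z0 /= mod0z eqxx ltnn.
rewrite norm_of_Zp//; congr (_ ^- _); apply/eqP.
by rewrite eqn_leq -zk -padic_int_valP// leqnn padic_int_valP// zk leqnn.
Qed.

Lemma norm_of_Zp_le1 z : norm (of_Zp z) <= 1.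
Proof. by have := norm_of_Zp_le z 0; rewrite residue0 eqxx expr0 invr1. Qed.

Lemma norm_of_ZpB_le z w k : (norm (of_Zp z - of_Zp w) <= p%:R ^- k) <-> z k = w k.
Proof. by rewrite -of_ZpB norm_of_Zp_le; rewrite -residueB_eq0; split => /eqP. Qed.

Lemma norm_le_trans x y z r : norm (x - y) <= r -> norm (y - z) <= r ->
  norm (x - z) <= r.
Proof.
move=> xy yz; have -> : x - z = (x - y) + (y - z) by rewrite addrA subrK.
by apply: le_trans (padic_norm_ultra _ _ _) _; rewrite ge_max xy.
Qed.

Lemma norm_distC x y : norm (x - y) = norm (y - x).
Proof. by rewrite -padic_normN opprB. Qed.

(** Dividing [a] and [b] by the power of [p] in [b] makes the
denominator prime to [p], hence invertible modulo powers of [p] by Bezout. *)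
Lemma padic_int_approx (a b : Zp) m : b != 0 ->
  norm (of_Zp a / of_Zp b) <= 1 ->
  exists z : Zp, norm (of_Zp a / of_Zp b - of_Zp z) <= p%:R ^- m.
Proof.
move=> b0; have b0' : of_Zp b != 0 by rewrite /of_Zp tofrac_eq0.
set v := padic_int_val b => ab1.
have nb : norm (of_Zp b) = p%:R ^- v by exact: norm_of_Zp.
have na : norm (of_Zp a) <= p%:R ^- v.
  by rewrite -nb -[X in norm X](divfK b0') padic_normM ler_piMl ?padic_norm_ge0.
pose M := (v + m).+1.
have vM : (v <= M)%N by rewrite /M leqW// leq_addr.
have [b' bM pb'] := @padic_int_dvd _ _ b M b0 (leq_addr _ _ : (v < M)%N).
move: na; rewrite norm_of_Zp_le (residue_eq0 _ vM) => /dvdzP[a' aM].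
have /coprimezP[[u w] /= uw] : coprimez b' (q m.+1).
  by rewrite coprimezE abszX coprimeXr// coprime_sym absz_nat prime_coprime//.
exists (padic_int_of p_prime (a' * u)).
have -> : of_Zp a / of_Zp b - of_Zp (padic_int_of p_prime (a' * u))
   = of_Zp (a - padic_int_of p_prime (a' * u) * b) / of_Zp b.
  by rewrite of_ZpB of_ZpM mulrBl mulfK.
have pv : 0 < p%:R ^- v :> R by rewrite invr_gt0 exprn_gt0.
rewrite -(ler_pM2r pv) -[in X in X <= _]nb -padic_normM divfK//.
rewrite -invfM -exprD addnC.
have -> : norm (of_Zp (a - padic_int_of p_prime (a' * u) * b)) <= p%:R ^- (v + m).
  apply: le_trans (_ : p%:R ^- M <= _); last first.
    by rewrite lef_pV2 ?posrE ?exprn_gt0// ler_weXn2l// ltW.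
  rewrite norm_of_Zp_le; apply/eqP/residueB_eq0.
  rewrite residueM /= modzMml -(residue_mod a) aM bM; apply/eqP.
  rewrite eqz_mod_dvd.
  have -> : a' * q (padic_int_val b) - a' * u * (b' * q (padic_int_val b))
    = a' * w * q M.
    rewrite /M -addnS exprD -/v.
    have -> : a' * q v = a' * q v * (u * b' + w * q m.+1) by rewrite uw mulr1.
    by ring.
  exact: dvdz_mull.
by [].
Qed.

Lemma padic_complete (x : nat -> Zp) : (forall k, x k.+1 k = x k k) ->
  exists z : Zp, forall k, z k = x k k.
Proof.
move=> xk.
have h k : x k k = (x k.+1 k.+1 %% q k)%Z by rewrite -xk residueP.
by exists (PadicInt p_prime h).
Qed.

Lemma padic_intP (y : Qp) : norm y <= 1 -> exists z, y = of_Zp z.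
Proof.
have [a [_ [b [b0 -> _]]]] := padic_common_denom y y.
rewrite -/(of_Zp a) -/(of_Zp b) => y1.
have /choice[x xP] m := padic_int_approx m b0 y1.
have [k|z zP] := @padic_complete x.
  apply/norm_of_ZpB_le; apply: norm_le_trans (xP k).
  rewrite norm_distC; apply: le_trans (xP k.+1) _.
  by rewrite lef_pV2 ?posrE ?exprn_gt0// ler_weXn2l// ltW.
exists z; apply/eqP; rewrite -subr_eq0; apply/eqP.
set y' := _ - _; apply: contrapT => /eqP y0.
have [k] : exists k, p%:R ^- k < norm y'.
  exists `|padic_val y'|%N.+1.
  by rewrite /padic_norm (negbTE y0) exprnN ltr_eXz2l//; lia.
rewrite ltNge => /negP; apply; apply: norm_le_trans (xP k) _.
exact/norm_of_ZpB_le.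
Qed.

(** The representative is chosen as a function of the set of all
candidates, which is the coset of [y] modulo the unit ball; so it is the same
for all elements of this coset. *)
Definition coset_repr (y : Qp) : Qp := xget 0 [set r | norm (y - r) <= 1]%classic.

(** On each coset of the unit ball this is a translation, so it
moves balls of radius at most 1 to balls and segments of unit length to
segments: lines need not start inside the unit ball to have residues. *)
Definition integral_part (y : Qp) : Zp :=
  xget 0 [set z | of_Zp z = y - coset_repr y]%classic.

Lemma of_Zp_integral_part y : of_Zp (integral_part y) = y - coset_repr y.
Proof.
have : norm (y - coset_repr y) <= 1.
  rewrite /coset_repr; case: xgetP => [r _ //|/(_ y)/=].
  by rewrite subrr padic_norm0 ler01.
move=> /padic_intP[z ez]; rewrite /integral_part.
by case: xgetP => [w _ //|/(_ z)/=]; rewrite ez.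
Qed.

Lemma integral_partD y z : integral_part (y + of_Zp z) = integral_part y + z.
Proof.
apply: of_Zp_inj; rewrite of_ZpD !of_Zp_integral_part.
suff -> : coset_repr (y + of_Zp z) = coset_repr y by rewrite addrAC.
rewrite /coset_repr; congr xget; apply/funext => r; apply/propext => /=.
have le1 (w : Zp) (u v : Qp) : v = u + of_Zp w -> norm u <= 1 -> norm v <= 1.
  move=> -> u1; apply: le_trans (padic_norm_ultra _ _ _) _.
  by rewrite ge_max u1 norm_of_Zp_le1.
split.
  by apply: (le1 (- z)); rewrite -[- z]sub0r of_ZpB /of_Zp tofrac0; ring.
by apply: (le1 z); ring.
Qed.

Lemma integral_part_residue y y' k : norm (y - y') <= p%:R ^- k ->
  integral_part y k = integral_part y' k.
Proof.
move=> yy'; have /padic_intP[z ez] : norm (y - y') <= 1.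
  by apply: le_trans yy' _; rewrite invf_le1 ?exprn_gt0// exprn_ege1// ltW.
have /eqP zk : z k == 0 by rewrite -norm_of_Zp_le -ez.
have -> : y = y' + of_Zp z by rewrite -ez addrCA subrr addr0.
by rewrite integral_partD residueD zk addr0 residue_mod.
Qed.

End IntegralPart.

(** * Kakeya sets seen through their residues *)

Section Residues.
Variables (p : nat) (p_prime : prime p).
Local Notation Zp := (padic_int p_prime).
Let p_gt0 : (0 < p)%N := prime_gt0 p_prime.

Lemma PoszX a m : (a ^ m)%N%:Z = a%:Z ^+ m.
Proof. by rewrite -[LHS]natz natrX natz. Qed.

Lemma residue_ge0 (z : Zp) m : 0 <= z m.
Proof. by rewrite -residue_mod modz_ge0// q_neq0. Qed.

Lemma residue_lt (z : Zp) m : (`|z m| < p ^ m)%N.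
Proof.
rewrite -ltz_nat gez0_abs ?residue_ge0// -residue_mod PoszX.
by rewrite ltz_pmod// exprn_gt0.
Qed.

Definition ord_residue m (z : Zp) : 'I_(p ^ m) := Ordinal (residue_lt z m).

Lemma ord_residueE m (z : Zp) : (ord_residue m z)%:Z = z m.
Proof. by rewrite /= gez0_abs ?residue_ge0. Qed.

Lemma pX_gt0 m : (0 < p ^ m)%N. Proof. by rewrite expn_gt0 p_gt0. Qed.

Definition reduce_tuple r m (t : r.-tuple 'I_(p ^ m.+1)) : r.-tuple 'I_(p ^ m) :=
  [tuple Ordinal (ltn_pmod (tnth t i) (pX_gt0 m)) | i < r].

Lemma card_reduce_fiber r m (t : r.-tuple 'I_(p ^ m)) :
  (p ^ r <= #|[set u | reduce_tuple u == t]|)%N.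
Proof.
have digit_lt (i : 'I_r) (e : r.-tuple 'I_p) :
    (tnth t i + p ^ m * tnth e i < p ^ m.+1)%N.
  by have := ltn_ord (tnth t i); have := ltn_ord (tnth e i); rewrite expnS; nia.
pose ext (e : r.-tuple 'I_p) := [tuple Ordinal (digit_lt i e) | i < r].
have ext_inj : injective ext.
  move=> e e' /(congr1 (fun u => tnth u)) ee'; apply: eq_from_tnth => i.
  have := congr1 (fun u => nat_of_ord (u i)) ee'; rewrite !tnth_mktuple /=.
  move/addnI/eqP; rewrite eqn_pmul2l ?pX_gt0// => /eqP; exact: val_inj.
rewrite -[X in (X ^ _)%N]card_ord -card_tuple -(card_imset _ ext_inj).
apply: subset_leq_card; apply/fintype.subsetP => _ /imsetP[e _ ->].
rewrite inE; apply/eqP/eq_from_tnth => i; apply: val_inj.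
by rewrite !tnth_mktuple /= addnC mulnC modnMDl modn_small.
Qed.

Definition tuple_residue r m (z : 'I_r -> Zp) : r.-tuple 'I_(p ^ m) :=
  [tuple ord_residue m (z i) | i < r].

(** [exists_branch] read backwards, for the tree of vectors of
residues; its branches are the vectors of [p]-adic integers. *)
Lemma dense_level r (E : forall m, {set r.-tuple 'I_(p ^ m)}) :
  (forall z, exists m, tuple_residue m z \in E m) ->
  exists m, ((p ^ m) ^ r < #|E m| * (m.+1 * m.+2))%N.
Proof.
move=> hit; apply: contrapT => /forallNP nodense.
have small m : (#|E m| * (m.+1 * m.+2) <= (p ^ r) ^ m)%N.
  by rewrite -expnM [(r * m)%N]mulnC expnM leqNgt; apply/negP/nodense.
have [||x [xred xE]] := exists_branch (@card_reduce_fiber r) _ _ small.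
- by rewrite card_tuple card_ord expn0 exp1n.
- by rewrite expn_gt0 p_gt0.
have coh i k : (tnth (x k) i)%:Z = ((tnth (x k.+1) i)%:Z %% p%:Z ^+ k)%Z.
  by rewrite -[in LHS](xred k) tnth_mktuple /= -PoszX modz_nat.
have [m] := hit (fun i => PadicInt p_prime (coh i)).
suff -> : tuple_residue m (fun i => PadicInt p_prime (coh i)) = x m.
  by rewrite (negbTE (xE m)).
apply: eq_from_tnth => i; rewrite tnth_mktuple; exact: val_inj.
Qed.

Lemma dense_level1 (E : forall m, {set 'I_(p ^ m)}) :
  (forall z : Zp, exists m, ord_residue m z \in E m) ->
  exists m, (p ^ m < #|E m| * (m.+1 * m.+2))%N.
Proof.
move=> hit; pose E1 m := [set [tuple l] | l in E m].
have [z|m] := @dense_level 1 E1.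
  have [m zm] := hit (z ord0); exists m; apply/imsetP.
  exists (ord_residue m (z ord0)) => //.
  by apply: eq_from_tnth => i; rewrite tnth_mktuple ord1 tnth0.
rewrite expn1 card_imset => [|l l' /(congr1 (fun t => tnth t ord0))//].
by exists m.
Qed.

End Residues.

Section KakeyaResidues.
Variables (R : realType) (p : nat) (p_prime : prime p) (n : nat).
Local Notation Zp := (padic_int p_prime).
Local Notation V := (padic_space R p_prime n).

Definition vector_residue m (y : V) : n.-tuple 'I_(p ^ m) :=
  tuple_residue m (fun i => integral_part R ((y : 'rV[padic p_prime]_n) 0 i)).

Lemma vector_residue_eq m (x y : V) : padic_vnorm (x - y) <= p%:R ^- m ->
  vector_residue m x = vector_residue m y.
Proof.
move=> xy; apply: eq_from_tnth => i; rewrite !tnth_mktuple; apply: val_inj => /=.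
congr absz; apply: (@integral_part_residue R); apply: le_trans xy.
by have := padic_vnorm_ge (x - y : V) i; rewrite !mxE.
Qed.

Lemma vector_residue_line (b : V) (x : 'I_n -> Zp) (l : Zp) m :
  on_line (vector_residue m b) (tuple_residue m x) (ord_residue m l)
    (vector_residue m (b + of_Zp l *: (\row_i of_Zp (x i) : V))).
Proof.
apply/forallP => i; rewrite !tnth_mktuple -eqz_nat -!modz_nat PoszD PoszM.
rewrite !ord_residueE !mxE -of_ZpM integral_partD.
by rewrite residueD residueM PoszX modzDmr modz_mod.
Qed.

(** Two applications of [dense_level].  For a fixed direction, the
parameters of its line give a level at which the line is rich in points of
[S]; so the rich directions, over all levels, exhaust the directions, and some
level has many of them. *)
Lemma kakeya_residues (K : set V) (S : forall m, {set n.-tuple 'I_(p ^ m)}) :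
  kakeya_set K -> (forall y, K y -> exists m, vector_residue m y \in S m) ->
  exists m, (0 < #|S m|)%N /\
    forall d, (n * d * m.+1 * (m.+1 * m.+2) ^ 2 < p ^ m)%N -> (d ^ n <= #|S m|)%N.
Proof.
move=> [_ lineK] KS.
pose rich m (a x : n.-tuple 'I_(p ^ m)) :=
  (p ^ m < #|line_params (S m) a x| * (m.+1 * m.+2))%N.
pose D m := [set x : n.-tuple 'I_(p ^ m) | [exists a, rich m a x]].
have [z|m cD] := @dense_level p p_prime n D.
  pose x : V := \row_i of_Zp (z i).
  have [i|b bK] := lineK x; first by rewrite mxE norm_of_Zp_le1.
  pose E m := line_params (S m) (vector_residue m b) (tuple_residue m z).
  have [l|m Em] := @dense_level1 p p_prime E.
    have [m ym] := KS _ (bK _ (norm_of_Zp_le1 R l)); exists m.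
    by rewrite inE; apply/exists_inP; eexists; [exact: ym|exact: vector_residue_line].
  by exists m; rewrite inE; apply/existsP; exists (vector_residue m b).
pose a (x : n.-tuple 'I_(p ^ m)) := odflt x [pick a | rich m a x].
have aP x : x \in D m -> rich m (a x) x.
  by rewrite inE /a => /existsP[a0 a0x]; case: pickP => //= /(_ a0); rewrite a0x.
exists m; split.
  have /card_gt0P[x /aP] : (0 < #|D m|)%N.
    by move: cD; case: #|D m| => //; rewrite mul0n.
  rewrite /rich => xr; have /card_gt0P[l] : (0 < #|line_params (S m) (a x) x|)%N.
    by move: xr; case: #|_| => //; rewrite mul0n.
  by rewrite inE => /exists_inP[s sS _]; apply/card_gt0P; exists s.
move=> d hd; apply: (@finite_kakeya p m n d p_prime (S m) a).
set w := (m.+1 * m.+2)%N in cD hd aP *.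
have sumD : (#|D m| * p ^ m <= (\sum_x #|line_params (S m) (a x) x|) * w)%N.
  rewrite big_distrl /= (bigID (mem (D m)))/=; apply: leq_trans (leq_addr _ _).
  by rewrite -sum_nat_const leq_sum// => x /aP /ltnW.
set Q := (p ^ m)%N in cD hd sumD *; set s := \sum_x _ in sumD *.
have w0 : (0 < w)%N by [].
have h1 : (Q ^ n * Q < #|D m| * w * Q)%N.
  by rewrite ltn_pmul2r ?expn_gt0 ?prime_gt0.
have h2 : (#|D m| * w * Q <= s * w * w)%N by rewrite mulnAC leq_pmul2r.
have h3 : (n * d * m.+1 * w ^ 2 * Q ^ n <= Q * Q ^ n)%N.
  by rewrite leq_mul2r ltnW ?orbT.
rewrite -(ltn_pmul2r w0) -(ltn_pmul2r w0); apply: leq_ltn_trans (leq_trans h1 h2).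
by rewrite mulnC in h3; nia.
Qed.

End KakeyaResidues.

(** * Real estimates *)

Section Growth.
Variable R : realType.

Lemma poly_lt_expR (A c : R) : 0 < c ->
  exists m0, forall m, (m0 <= m)%N -> A * m.+2%:R ^+ 5 < expR (c * m%:R).
Proof.
move=> c0; pose b : R := Num.min (2^-1) (c / 6).
have b0 : 0 < b by rewrite lt_min invr_gt0 ltr0n divr_gt0.
have b2 : b <= 2^-1 by rewrite ge_min lexx.
have bc : b <= c / 6 by rewrite ge_min lexx orbT.
exists (Num.truncn (A / b ^+ 6)).+1 => m hm.
have m2 : 0 < m.+2%:R :> R by rewrite ltr0n.
(* The sixth power of this linear bound beats the fifth power of [m + 2]. *)
have lin : b * m.+2%:R <= expR (c * m%:R / 6).
  apply: le_trans (expR_ge1Dx _).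
  have -> : m.+2%:R = m%:R + 2 :> R by rewrite -addn2 natrD.
  rewrite mulrDr addrC lerD//; first by lra.
  by rewrite mulrAC ler_wpM2r.
have -> : expR (c * m%:R) = expR (c * m%:R / 6) ^+ 6.
  by rewrite -expRM_natr divfK// pnatr_eq0.
apply: lt_le_trans (_ : (b * m.+2%:R) ^+ 6 <= _); last first.
  by rewrite lerXn2r// ?nnegrE ?expR_ge0// mulr_ge0// ltW.
rewrite exprMn [m.+2%:R ^+ 6]exprS mulrA ltr_pM2r ?exprn_gt0//.
rewrite mulrC -ltr_pdivrMr ?exprn_gt0//.
by apply: lt_le_trans (truncnS_gt _) _; rewrite ler_nat !leqW.
Qed.

(** [d] is about [p ^ (m s / n)] times a constant; the first
inequality then compares a polynomial in [m] with
[p ^ (m (1 - s / n))]. *)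
Lemma exists_degree (p n : nat) (s C : R) : (1 < p)%N -> (0 < n)%N ->
  0 <= s -> s < n%:R -> 0 <= C ->
  exists m0, forall m, (m0 <= m)%N -> exists d,
    (n * d * m.+1 * (m.+1 * m.+2) ^ 2 < p ^ m)%N /\
    C * (p%:R ^+ m) `^ s <= (d ^ n)%:R.
Proof.
move=> p1 n0 s0 sn C0; pose C' := Num.max 1 C.
have C1 : 1 <= C' by rewrite le_max lexx.
have CC : C <= C' by rewrite le_max lexx orbT.
have nR : 0 < n%:R :> R by rewrite ltr0n.
have pR : 0 < p%:R :> R by rewrite ltr0n ltnW.
have lnp : 0 < ln p%:R :> R by rewrite ln_gt0// ltr1n.
pose t := s / n%:R; have t0 : 0 <= t by rewrite divr_ge0// ltW.
have t1 : t < 1 by rewrite ltr_pdivrMr// mul1r.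
have [|m0 hm0] := @poly_lt_expR (n%:R * (C' + 1)) ((1 - t) * ln p%:R).
  by rewrite mulr_gt0// subr_gt0.
exists m0 => m /hm0 hm; pose X := (p%:R ^+ m : R) `^ t.
have pm : 1 <= p%:R ^+ m :> R by rewrite exprn_ege1// ler1n ltnW.
have pm0 : 0 < p%:R ^+ m :> R by rewrite exprn_gt0.
have X1 : 1 <= X.
  have := ge0_ler_powR t0 (_ : 1 \in Num.nneg) (_ : p%:R ^+ m \in Num.nneg) pm.
  by rewrite powR1; apply; rewrite nnegrE ltW.
have X0 : 0 < X by lra.
pose d := (Num.truncn (C' * X)).+1; exists d.
have CX0 : 0 <= C' * X by rewrite mulr_ge0//; lra.
have Xd : C' * X <= d%:R by rewrite ltW// /d truncnS_gt.
have dX : d%:R <= (C' + 1) * X.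
  by have /andP[h _] := truncn_itv CX0; rewrite /d -natr1 mulrDl mul1r lerD.
split; last first.
  apply: le_trans (_ : (C' * X) ^+ n <= _); last first.
    by rewrite natrX lerXn2r ?nnegrE.
  rewrite exprMn ler_pM//.
  - by apply: le_trans CC _; rewrite ler_eXnr.
  by rewrite -(powR_mulrn n (ltW X0)) -powRrM /t divfK// gt_eqF.
rewrite -(ltr_nat R).
have hX : p%:R ^+ m = X * expR ((1 - t) * ln p%:R * m%:R) :> R.
  rewrite /X /powR gt_eqF// -expRD lnXn//.
  have -> : t * (ln p%:R *+ m) + (1 - t) * ln p%:R * m%:R = ln p%:R * m%:R :> R.
    by rewrite -(mulr_natr (ln _)); ring.
  by rewrite expRM_natr lnK.
rewrite natrX hX.
apply: le_lt_trans (_ : X * (n%:R * (C' + 1) * m.+2%:R ^+ 5) < _); last first.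
  by rewrite ltr_pM2l.
apply: le_trans (_ : (n * d * m.+2 ^ 5)%:R <= _).
  rewrite ler_nat -[X in (X <= _)%N]mulnA leq_mul2l; apply/orP; right.
  rewrite [X in (_ <= X)%N]expnS leq_mul// expnMn.
  by rewrite [X in (_ <= X)%N](expnD _ 2 2) leq_mul// leq_exp2r.
have -> : X * (n%:R * (C' + 1) * m.+2%:R ^+ 5) = n%:R * ((C' + 1) * X) * m.+2%:R ^+ 5.
  by ring.
rewrite (natrM _ (n * d)) (natrM _ n) natrX ler_wpM2r ?exprn_ge0//.
by rewrite ler_wpM2l// ltW.
Qed.

End Growth.

Lemma exists_pow_lt (R : realType) (a e : R) : 1 < a -> 0 < e -> exists m0, forall m,
  (m0 <= m)%N -> a ^- m < e.
Proof.
move=> a1 e0; have a0 : 0 < a by lra.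
exists (Num.truncn (e^-1 / (a - 1))).+1 => m hm.
have a10 : 0 < a - 1 by lra.
have bern : m%:R * (a - 1) <= a ^+ m.
  elim: (m) => [|k ih]; first by rewrite mul0r expr0.
  have ak : 1 <= a ^+ k by rewrite exprn_ege1// ltW.
  by rewrite exprS -natr1; nra.
rewrite -[e]invrK ltf_pV2 ?posrE ?exprn_gt0 ?invr_gt0//.
apply: lt_le_trans bern; rewrite -ltr_pdivrMr//.
by apply: lt_le_trans (truncnS_gt _) _; rewrite ler_nat.
Qed.

Lemma powR_exp (R : realType) (a s : R) m : 0 <= a -> (a ^+ m) `^ s = (a `^ s) ^+ m.
Proof.
move=> a0; rewrite -(powR_mulrn m a0) -(powR_mulrn m (powR_ge0 a s)).
by rewrite -!(powRrM a) mulrC.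
Qed.

Lemma powR_expN (R : realType) (a s : R) m : 0 < a -> (a ^- m) `^ s = (a `^ s) ^- m.
Proof.
move=> a0; rewrite -!exprVn -!powR_mulrn ?invr_ge0 ?powR_ge0 ?(ltW a0)//.
rewrite -powRrM mulrC powRrM; congr (_ `^ _).
by rewrite -powR_inv1 ?ltW// -powRrM mulN1r -powR_inv1 ?powR_ge0// -powRrM mulrN1.
Qed.

Lemma exists_scale (R : realType) (a d : R) m0 : 1 < a -> 0 < d -> d <= a ^- m0 ->
  exists m, [/\ (m0 <= m)%N, a ^- m.+1 < d & d <= a ^- m].
Proof.
move=> a1 d0 dm0; have a0 : 0 < a by lra.
have exm : exists m, a ^- m < d.
  by have [m1 hm1] := exists_pow_lt a1 d0; exists m1; exact: hm1.
have [M hM minM] := ex_minnP exm.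
have M0 : (m0 < M)%N.
  rewrite ltnNge; apply/negP => Mm0; move: hM; rewrite ltNge => /negP; apply.
  by apply: le_trans dm0 _; rewrite lef_pV2 ?posrE ?exprn_gt0// ler_weXn2l// ltW.
case: M M0 hM minM => // m; rewrite ltnS => mm0 hM minM.
by exists m; split=> //; rewrite leNgt; apply/negP => /minM; rewrite ltnn.
Qed.

Lemma sum_uniq_le (R : realType) (f : nat -> R) (I : seq nat) : uniq I ->
  (forall i, 0 <= f i) ->
  exists N, \sum_(i <- I) f i <= \sum_(0 <= i < N) f i.
Proof.
move=> uI f0; exists (\max_(i <- I) i).+1.
set N := _.+1.
have perm : perm_eq I [seq i <- index_iota 0 N | i \in I].
  apply: uniq_perm => //; first by rewrite filter_uniq// iota_uniq.
  move=> i; rewrite mem_filter mem_index_iota /= ltnS.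
  by case: (boolP (i \in I)) => //= iI; rewrite (leq_bigmax_seq _ iI).
rewrite (perm_big _ perm) big_filter big_mkcond ler_sum// => i _.
by case: ifP.
Qed.

Lemma sum_half_powers (R : realType) N :
  \sum_(0 <= i < N) (2 : R) ^- i.+1 = 1 - 2 ^- N.
Proof.
elim: N => [|N ih]; first by rewrite big_geq// expr0 invr1 subrr.
by rewrite big_nat_recr//= ih exprS invfM; field; rewrite expf_neq0.
Qed.

(** * Covers of Kakeya sets *)

Section Covers.
Local Open Scope classical_set_scope.
Variables (R : realType) (p : nat) (p_prime : prime p) (n : nat).
Local Notation V := (padic_space R p_prime n).
Local Notation Qp := (padic p_prime).
Let pR_gt0 : 0 < p%:R :> R. Proof. by rewrite ltr0n prime_gt0. Qed.

Lemma mdist_padic (x y : V) : mdist x y = padic_vnorm (x - y).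
Proof. by []. Qed.

Lemma mdist_ultra (x y z : V) r : 0 <= r ->
  mdist x y <= r -> mdist y z <= r -> mdist x z <= r.
Proof.
rewrite !mdist_padic => r0 xy yz; apply/bigmax_leP; split=> // i _.
have h (u v : V) : padic_vnorm (u - v) <= r ->
    padic_norm R ((u : 'rV[Qp]_n) 0 i - (v : 'rV[Qp]_n) 0 i) <= r.
  by move=> uv; apply: le_trans uv; have := padic_vnorm_ge (u - v : V) i; rewrite !mxE.
by have := norm_le_trans (h _ _ xy) (h _ _ yz); rewrite !mxE.
Qed.

Lemma ball_mdist_le (c x y : V) r : 0 <= r ->
  mdist c x <= r -> mdist c y <= r -> mdist x y <= r.
Proof. by move=> r0 cx; apply: mdist_ultra => //; rewrite metric_sym. Qed.

(** A set of diameter at most [p ^ - m] has a single residue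
modulo [p ^ m], so the number of residues in [kakeya_residues] bounds from below
the number of sets of the cover used at that level. *)
Lemma kakeya_cover_level (K : set V) (s C : R) : (0 < n)%N -> kakeya_set K ->
  0 <= s -> s < n%:R -> 0 <= C ->
  exists m0, forall (U : nat -> set V) (lev : nat -> nat),
    (forall i, (m0 <= lev i)%N) ->
    (forall i x y, U i x -> U i y -> mdist x y <= p%:R ^- lev i) ->
    K `<=` \bigcup_i U i ->
    exists m, exists I : seq nat, [/\ uniq I,
      forall i, i \in I -> lev i = m /\ U i !=set0 &
      C * (p%:R ^+ m) `^ s <= (size I)%:R].
Proof.
move=> n0 kK s0 sn C0.
have [m0 hm0] := exists_degree (prime_gt1 p_prime) n0 s0 sn C0.
exists m0 => U lev levm0 diamU KU.
pose S m := finset (fun t =>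
  `[< exists i y, [/\ lev i = m, U i y & vector_residue m y = t] >]).
have [y /KU[i _ Uiy]|m [/card_gt0P[t0 t0S] cS]] := @kakeya_residues R p p_prime n K S kK.
  by exists (lev i); rewrite inE; apply/asboolP; exists i, y.
have /choice[h hP] (t : n.-tuple 'I_(p ^ m)) : exists i, t \in S m ->
    lev i = m /\ exists2 y, U i y & vector_residue m y = t.
  have [|] := boolP (t \in S m); last by exists 0%N.
  rewrite inE => /asboolP[i [y [li Uy ty]]]; exists i => _; split=> //.
  by exists y.
have mm0 : (m0 <= m)%N by have [l0 _] := hP t0 t0S; rewrite -l0.
have [d [hd Cd]] := hm0 m mm0.
exists m, (map h (enum (S m))); split.
- rewrite map_inj_in_uniq ?enum_uniq// => t t'; rewrite !mem_enum => tS t'S htt'.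
  have [lt [y Uy <-]] := hP t tS; have [_ [y' Uy' <-]] := hP t' t'S.
  by apply: vector_residue_eq; rewrite -lt -mdist_padic; apply: diamU; rewrite // htt'.
- move=> i /mapP[t]; rewrite mem_enum => tS ->.
  by have [lt [y Uy _]] := hP t tS; split=> //; exists y.
by rewrite size_map -cardE (le_trans Cd)// ler_nat cS.
Qed.

Lemma kakeya_bounded_cover (K : set V) : kakeya_set K ->
  exists M, forall m, exists c : 'I_((p ^ (M + m)) ^ n) -> V,
    forall x, K x -> exists i, mdist (c i) x <= p%:R ^- m.
Proof.
move=> [[B KB] _].
have [M BM] : exists M, B <= p%:R ^+ M.
  exists (Num.truncn B).+1; apply: le_trans (ltW (truncnS_gt B)) _.
  by rewrite -natrX ler_nat ltnW// ltn_expl// prime_gt1.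
exists M => m.
(* Multiplication by [P] maps the bounded set into the unit ball. *)
pose P : Qp := of_Zp (padic_int_of p_prime (p%:Z ^+ M)).
have nP : padic_norm R P = p%:R ^- M by exact: norm_of_Zp_expn.
have pX0 k : 0 < p%:R ^+ k :> R by rewrite exprn_gt0.
have P0 : P != 0.
  apply/eqP => P0; move: nP; rewrite P0 padic_norm0 => /esym/eqP.
  by rewrite gt_eqF// invr_gt0.
pose ctr (t : n.-tuple 'I_(p ^ (M + m))) : V :=
  \row_i (of_Zp (padic_int_of p_prime (tnth t i)%:Z) / P).
have cT : ((p ^ (M + m)) ^ n)%N = #|{: n.-tuple 'I_(p ^ (M + m))}|.
  by rewrite card_tuple card_ord.
exists (fun i => ctr (enum_val (cast_ord cT i))) => x /KB xB.
have /choice[z zE] (i : 'I_n) : exists z : padic_int p_prime,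
    (x : 'rV[Qp]_n) 0 i * P = of_Zp z.
  apply: (@padic_intP R); rewrite padic_normM nP ler_pdivrMr ?mul1r//.
  exact: le_trans (padic_vnorm_ge x i) (le_trans xB BM).
exists (cast_ord (esym cT) (enum_rank (tuple_residue (M + m) z))).
rewrite cast_ordKV enum_rankK mdist_padic.
apply/bigmax_leP; split=> [|i _]; first by rewrite invr_ge0 ltW.
rewrite !mxE tnth_mktuple -(mulfK P0 ((x : 'rV[Qp]_n) 0 i)) zE -mulrBl.
rewrite -(ler_pM2r (_ : 0 < padic_norm R P)); last by rewrite nP invr_gt0.
rewrite -padic_normM divfK// nP -invfM -exprD addnC; apply/norm_of_ZpB_le.
by rewrite /= ord_residueE residue_mod.
Qed.

End Covers.

(** * Diameters *)

Section Diameter.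
Local Open Scope classical_set_scope.
Context {R : realType} {T : metricType R}.
Implicit Types U : set T.

Lemma diameter_ge U x y : U x -> U y -> ((mdist x y)%:E <= diameter U)%E.
Proof. by move=> Ux Uy; apply: ereal_sup_ubound; right; exists x => //; exists y. Qed.

Lemma diameter_ge0 U : (0 <= diameter U)%E.
Proof. by apply: ereal_sup_ubound; left. Qed.

Lemma diameter_le U r : 0 <= r -> (forall x y, U x -> U y -> mdist x y <= r) ->
  (diameter U <= r%:E)%E.
Proof.
move=> r0 Ur; apply: ge_ereal_sup => _ [->|[x Ux [y Uy <-]]].
  by rewrite lee_fin.
by rewrite lee_fin Ur.
Qed.

Lemma diameter_pow_ge0 s U : (0 <= diameter_pow s U)%E.
Proof. by rewrite /diameter_pow; case: ifP => // _; exact: poweR_ge0. Qed.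

Lemma diameter_pow_le s U r : 0 <= s -> 0 <= r ->
  (forall x y, U x -> U y -> mdist x y <= r) ->
  (diameter_pow s U <= (r `^ s)%:E)%E.
Proof.
move=> s0 r0 Ur; rewrite /diameter_pow; case: ifP => _.
  by rewrite lee_fin powR_ge0.
rewrite -poweR_EFin; apply: gt0_ler_poweR => //.
- by rewrite in_itv /= diameter_ge0 leey.
- by rewrite in_itv /= lee_fin r0 leey.
- exact: diameter_le.
Qed.

(** Rounds the diameter of [U] up to a power of [a^-1], at the price of a
factor [a ^ s'].  The error term [e] pays for the sets of diameter 0, which have
no rounded diameter; [0 < s'] makes arbitrarily small payments possible, even
when [s] is 0. *)
Lemma exists_ball_level (a s s' e : R) (U : set T) m0 : 1 < a -> 0 <= s -> s < s' ->
  0 < e -> (diameter U <= (a ^- m0)%:E)%E ->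
  exists m, [/\ (m0 <= m)%N, forall x y, U x -> U y -> mdist x y <= a ^- m &
    (((a ^- m) `^ s')%:E <= (a `^ s')%:E * diameter_pow s U + e%:E)%E].
Proof.
move=> a1 s0 ss' e0 dU; have a0 : 0 < a by lra.
have s'0 : 0 < s' by lra.
have am1 m : a ^- m <= 1.
  by rewrite invf_le1 ?exprn_gt0// exprn_ege1// ltW.
have small : exists m, (m0 <= m)%N /\ (a ^- m) `^ s' <= e.
  have as1 : 1 < a `^ s' by rewrite /powR gt_eqF// expR_gt1 mulr_gt0// ln_gt0.
  have [m1 hm1] := exists_pow_lt as1 e0.
  exists (maxn m0 m1); split; first exact: leq_maxl.
  by rewrite powR_expN// ltW// hm1// leq_maxr.
have cst_ge0 : (0 <= (a `^ s')%:E * diameter_pow s U)%E.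
  by rewrite mule_ge0 ?lee_fin ?powR_ge0 ?diameter_pow_ge0.
have cheap m : (a ^- m) `^ s' <= e ->
    (((a ^- m) `^ s')%:E <= (a `^ s')%:E * diameter_pow s U + e%:E)%E.
  by move=> h; apply: (@le_trans _ _ e%:E); rewrite ?lee_fin ?leeDr.
have [U0|/set0P[u Uu]] := eqVneq U set0.
  have [m [mm0 hm]] := small; exists m; split=> //.
    by move=> x y; rewrite U0.
  exact: cheap.
have Un0 : U != set0 by apply/set0P; exists u.
have dfin : diameter U \is a fin_num.
  by rewrite ge0_fin_numE ?diameter_ge0// (le_lt_trans dU)// ltry.
pose dl := fine (diameter U).
have dE : diameter U = dl%:E by rewrite fineK.
have dl0 : 0 <= dl by rewrite -lee_fin -dE diameter_ge0.
have dlm : dl <= a ^- m0 by rewrite -lee_fin -dE.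
have distU x y : U x -> U y -> mdist x y <= dl.
  by move=> Ux Uy; rewrite -lee_fin -dE diameter_ge.
have [dz|dl_gt0] : dl = 0 \/ 0 < dl.
  by move: dl0; rewrite le_eqVlt => /predU1P[<-|]; [left|right].
  have [m [mm0 hm]] := small; exists m; split=> //.
    move=> x y Ux Uy; rewrite (le_trans (distU _ _ Ux Uy))// dz.
    by rewrite invr_ge0 exprn_ge0// ltW.
  exact: cheap.
have [m [mm0 hM dlm']] := exists_scale a1 dl_gt0 dlm.
exists m; split=> //; first by move=> x y Ux Uy; exact: le_trans (distU _ _ Ux Uy) dlm'.
rewrite /diameter_pow (negbTE Un0) dE poweR_EFin -EFinM -EFinD lee_fin.
have : a ^- m <= a * dl.
  by rewrite mulrC -ler_pdivrMr// -invfM mulrC -exprS ltW.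
move=> h; apply: le_trans (_ : a `^ s' * dl `^ s <= _); last by rewrite lerDl ltW.
apply: le_trans (_ : a `^ s' * dl `^ s' <= _).
  rewrite -powRM ?(ltW a0)//; apply: ge0_ler_powR h => //; first exact: ltW.
    by rewrite nnegrE invr_ge0 exprn_ge0// ltW.
  by rewrite nnegrE mulr_ge0// ltW.
rewrite ler_wpM2l ?powR_ge0// /powR gt_eqF//.
rewrite ler_expR ler_wnM2r ?ln_le0 ?(ltW ss')//.
exact: le_trans dlm (am1 _).
Qed.

End Diameter.

(** * Hausdorff and Minkowski dimensions *)

Section KakeyaDimension.
Local Open Scope classical_set_scope.
Variables (R : realType) (p : nat) (p_prime : prime p) (n : nat).
Hypothesis n_gt0 : (0 < n)%N.
Local Notation V := (padic_space R p_prime n).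
Variable K : set V.
Hypothesis kakeyaK : kakeya_set K.
Let pR_gt0 : 0 < p%:R :> R. Proof. by rewrite ltr0n prime_gt0. Qed.
Let pR_gt1 : 1 < p%:R :> R. Proof. by rewrite ltr1n prime_gt1. Qed.

(** If the measure vanished, a fine cover would have
cost less than 1; after rounding, with errors of sum at most 1, the sets of any
single level would cost at most [p ^ s' + 1] together, against
[kakeya_cover_level]. *)
Lemma kakeya_hausdorff_measure_neq0 s : 0 <= s -> s < n%:R ->
  hausdorff_measure s K != 0%E.
Proof.
move=> s0 sn; apply/eqP => H0.
(* [s'] has to lie strictly between [s] and [n], to satisfy both
   [exists_ball_level] and [kakeya_cover_level]. *)
pose s' := (s + n%:R) / 2.
have ss' : s < s' by rewrite /s'; lra.
have s'n : s' < n%:R by rewrite /s'; lra.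
have s'0 : 0 <= s' by lra.
set P := p%:R `^ s'; have P0 : 0 <= P by exact: powR_ge0.
have [|m0 coverP] := kakeya_cover_level (C := P + 2) n_gt0 kakeyaK s'0 s'n; first by lra.
have : (hausdorff_premeasure (p%:R ^- m0) s K < 1)%E.
  apply: (@le_lt_trans _ _ 0%E); last exact: lte01.
  rewrite -H0; apply: ereal_sup_ubound; exists (p%:R ^- m0) => //=.
  by rewrite invr_gt0 exprn_gt0.
move=> /ereal_inf_lt[_ [U [KU Usmall] <-] sumU].
have [c cE] : exists c : nat -> R, forall i, diameter_pow s (U i) = (c i)%:E.
  exists (fun i => fine (diameter_pow s (U i))) => i; rewrite fineK//.
  rewrite ge0_fin_numE ?diameter_pow_ge0//.
  apply: (@lt_trans _ _ 1%E); last exact: ltry.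
  apply: le_lt_trans sumU.
  have := @nneseries_lim_ge _ (fun i => diameter_pow s (U i)) xpredT 0 i.+1.
  rewrite big_nat_recr//= => /(_ (fun i _ _ => diameter_pow_ge0 s (U i))).
  by apply: le_trans; rewrite leeDr// sume_ge0// => j _; exact: diameter_pow_ge0.
have c0 i : 0 <= c i by rewrite -lee_fin -cE diameter_pow_ge0.
have csum N : \sum_(0 <= i < N) c i <= 1.
  rewrite -lee_fin -sumEFin; apply: le_trans (ltW sumU).
  under eq_bigr do rewrite -cE.
  by apply: nneseries_lim_ge => i _ _; exact: diameter_pow_ge0.
have e0 i : 0 < 2 ^- i.+1 :> R by rewrite invr_gt0 exprn_gt0.
have /choice[lev levP] i := exists_ball_level pR_gt1 s0 ss' (e0 i) (Usmall i).
have [i|i x y|//|m [I [uI Ilev sizeI]]] := coverP U lev.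
- by have [] := levP i.
- by have [_ + _] := levP i; exact.
have f0 i : 0 <= P * c i + 2 ^- i.+1 by rewrite addr_ge0 ?mulr_ge0// ltW.
have [N hN] := sum_uniq_le uI f0.
have : \sum_(i <- I) (p%:R ^- m) `^ s' <= P + 1.
  apply: le_trans (_ : \sum_(i <- I) (P * c i + 2 ^- i.+1) <= _).
    rewrite big_seq [leRHS]big_seq ler_sum// => i /Ilev[<- _].
    by have [_ _] := levP i; rewrite cE -EFinM -EFinD lee_fin.
  apply: le_trans hN _; rewrite big_split /= sum_half_powers; apply: lerD.
    by rewrite -mulr_sumr ler_piMr.
  by rewrite gerBl invr_ge0 exprn_ge0.
rewrite big_const_seq count_predT iter_addr_0 powR_expN//.
have Pm : 0 < P ^+ m by rewrite exprn_gt0// powR_gt0.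
rewrite -(mulr_natr _ (size I)) mulrC ler_pdivrMr// => small.
have := le_trans sizeI small.
rewrite powR_exp ?(ltW pR_gt0)//.
by rewrite ler_pM2r// lerD2l => h; lra.
Qed.

Lemma kakeya_hausdorff_measure_eq0 s : n%:R < s -> hausdorff_measure s K = 0%E.
Proof.
move=> ns; have s0 : 0 <= s by apply: le_trans (ltW ns).
have premeasure_ge0 d : (0 <= hausdorff_premeasure d s K)%E.
  apply: le_ereal_inf_tmp => _ [U _ <-]; apply: nneseries_ge0 => i _ _.
  exact: diameter_pow_ge0.
apply/eqP; rewrite eq_le; apply/andP; split; last first.
  apply: le_trans (premeasure_ge0 1) _; apply: ereal_sup_ubound.
  by exists 1; rewrite //= ltr01.
apply: ge_ereal_sup => _ [d /= d0 <-]; apply/lee_addgt0Pr => e e0; rewrite add0e.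
have [M coverM] := kakeya_bounded_cover kakeyaK.
(* [p ^ ((M + m) n)] balls of radius [p ^ - m] cost [p ^ (M n) a ^ - m]. *)
pose a : R := p%:R `^ s / p%:R ^+ n.
have pX0 k : 0 < p%:R ^+ k :> R by rewrite exprn_gt0.
have a1 : 1 < a.
  rewrite /a ltr_pdivlMr// mul1r -powR_mulrn ?(ltW pR_gt0)// /powR gt_eqF//.
  by rewrite ltr_expR ltr_pM2r// ln_gt0.
have [m1 hm1] := exists_pow_lt pR_gt1 d0.
have [m2 hm2] := exists_pow_lt a1 (divr_gt0 e0 (pX0 (M * n)%N)).
pose m := maxn m1 m2.
have [c cP] := coverM m; set N := ((p ^ (M + m)) ^ n)%N in c cP.
have pm0 : 0 <= p%:R ^- m :> R by rewrite invr_ge0 ltW.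
pose U i : set V := [set x | exists2 j : 'I_N, j = i :> nat &
  mdist (c j) x <= p%:R ^- m].
have Um i x y : U i x -> U i y -> mdist x y <= p%:R ^- m.
  move=> [j ji xj] [j' j'i yj']; apply: ball_mdist_le xj _ => //.
  by have -> : j = j' by apply: val_inj; rewrite /= ji j'i.
have Ularge i : (N <= i)%N -> diameter_pow s (U i) = 0%E.
  move=> Ni; rewrite /diameter_pow ifT//; apply/eqP; rewrite -subset0 => x [j ji _].
  by move: Ni; rewrite -ji leqNgt ltn_ord.
apply: (@le_trans _ _ (\sum_(i <oo) diameter_pow s (U i))%E).
  apply: ereal_inf_lbound; exists U => //; split.
    by move=> x /cP[j xj]; exists (nat_of_ord j) => //; exists j.
  move=> i; apply: diameter_le => [|x y Ux Uy]; first exact: ltW.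
  by apply: le_trans (Um i _ _ Ux Uy) _; rewrite ltW// hm1// leq_maxl.
rewrite (@nneseries_split _ _ 0 N); last by move=> i _; exact: diameter_pow_ge0.
rewrite add0n eseries0 ?adde0; last by move=> i Ni _; exact: Ularge.
apply: (@le_trans _ _ (\sum_(0 <= i < N) ((p%:R ^- m) `^ s)%:E)%E).
  by apply: lee_sum => i _; apply: diameter_pow_le => // x y; exact: Um.
rewrite sumEFin lee_fin big_const_nat iter_addr_0 subn0 powR_expN//.
rewrite -(mulr_natl _ N) /N !natrX exprD exprMn -exprM -mulrA.
have -> : (p%:R ^+ m) ^+ n * p%:R `^ s ^- m = a ^- m.
  by rewrite /a exprAC expr_div_n invf_div.
by rewrite mulrC -ler_pdivlMr// ltW// hm2// leq_maxr.
Qed.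

Lemma kakeya_hausdorff_dim : hausdorff_dim K = (n%:R)%:E.
Proof.
apply/eqP; rewrite eq_le; apply/andP; split.
  apply/lee_addgt0Pr => e e0; rewrite -EFinD; apply: ereal_inf_lbound.
  exists (n%:R + e) => //=; split; first by rewrite addr_ge0// ltW.
  by apply: kakeya_hausdorff_measure_eq0; rewrite ltrDl.
apply: le_ereal_inf_tmp => _ [s [s0 Hs] <-]; rewrite lee_fin leNgt.
by apply/negP => /(kakeya_hausdorff_measure_neq0 s0); rewrite Hs eqxx.
Qed.

Lemma covering_number_upper : exists M, forall m eps, p%:R ^- m <= eps ->
  (covering_number eps K <= ((p%:R ^+ (M + m)) ^+ n)%:E)%E.
Proof.
have [M coverM] := kakeya_bounded_cover kakeyaK; exists M => m eps meps.
have [c cP] := coverM m; apply: ereal_inf_lbound.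
exists ((p ^ (M + m)) ^ n)%N; last by rewrite !natrX.
exists c => x /cP[i xi]; exists i; exact: le_trans xi meps.
Qed.

Lemma covering_number_lower s : 0 <= s -> s < n%:R ->
  exists m0, forall m eps, (m0 <= m)%N -> eps <= p%:R ^- m ->
  (((p%:R ^+ m) `^ s)%:E <= covering_number eps K)%E.
Proof.
move=> s0 sn; have [m0 hm0] := kakeya_cover_level n_gt0 kakeyaK s0 sn ler01.
exists m0 => m eps mm0 meps; apply: le_ereal_inf_tmp => _ [k [c cP] <-].
have pm0 : 0 <= p%:R ^- m :> R by rewrite invr_ge0 exprn_ge0// ltW.
pose U i : set V := [set x | exists2 j : 'I_k, j = i :> nat & mdist (c j) x <= eps].
have [i x y|x /cP[j xj]|m' [I [uI Im sizeI]]] := hm0 U (fun=> m) (fun=> mm0).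
- move=> [j ji xj] [j' j'i yj']; apply: ball_mdist_le (le_trans xj meps) _ => //.
  have -> : j = j' by apply: val_inj; rewrite /= ji j'i.
  exact: le_trans meps.
- by exists (nat_of_ord j) => //; exists j.
have sizeIk : (size I <= k)%N.
  rewrite -(size_iota 0 k); apply: uniq_leq_size => // i /Im[_ [x [j <- _]]].
  by rewrite mem_iota /= add0n.
case: I Im uI sizeI sizeIk => [_ _|i I Im _ sizeI sizeIk].
  by rewrite mul1r => /(lt_le_trans (powR_gt0 _ (exprn_gt0 _ pR_gt0))); rewrite ltxx.
have [mm' _] := Im i (mem_head _ _).
rewrite lee_fin (le_trans _ (_ : (size (i :: I))%:R <= _)) ?ler_nat//.
by rewrite mm' -[leLHS]mul1r.
Qed.

(** With [p ^ - (m + 1) < eps <= p ^ - m], the logarithm of the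
covering number lies between [s m ln p] and [n (M + 1 + m) ln p], while
[ln (1 / eps)] lies between [m ln p] and [(m + 1) ln p]; the bounded errors are
absorbed when [eps] is small. *)
Lemma kakeya_box_ratio e : 0 < e -> exists2 d, 0 < d & forall eps, 0 < eps -> eps < d ->
  exists2 g : R,
    (lne (covering_number eps K) * ((ln eps^-1)^-1)%:E = g%:E)%E & `|n%:R - g| <= e.
Proof.
move=> e0; pose s : R := Num.max 0 (n%:R - e / 2).
have nR : 0 < n%:R :> R by rewrite ltr0n.
have s0 : 0 <= s by rewrite le_max lexx.
have sn : s < n%:R by rewrite gt_max nR /=; lra.
have se : n%:R - e / 2 <= s by rewrite le_max lexx orbT.
have [m0 lower] := covering_number_lower s0 sn.
have [M upper] := covering_number_upper.
set L := ln (p%:R : R); have L0 : 0 < L by rewrite ln_gt0.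
pose B := 1 + (n%:R * M.+1%:R + 2 * s) * L / e.
have B0 : 0 < B.
  rewrite ltr_pwDl// divr_ge0 ?(ltW e0)// mulr_ge0 ?(ltW L0)//.
  by rewrite addr_ge0 ?mulr_ge0// ltW.
exists (Num.min (p%:R ^- m0) (expR (- B))).
  by rewrite lt_min expR_gt0 invr_gt0 exprn_gt0.
move=> eps eps0; rewrite lt_min => /andP[epsm0 epsB].
have [m [mm0 epsm1 epsm]] := exists_scale pR_gt1 eps0 (ltW epsm0).
have lo := lower m eps mm0 epsm; have up := upper m.+1 eps (ltW epsm1).
have pmX k : 0 < p%:R ^+ k :> R by rewrite exprn_gt0.
have covfin : covering_number eps K \is a fin_num.
  rewrite ge0_fin_numE; first by apply: le_lt_trans up _; exact: ltry.
  by apply: le_trans lo; rewrite lee_fin powR_ge0.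
move: lo up; rewrite -(fineK covfin); set r := fine _; rewrite !lee_fin => lo up.
have r0 : 0 < r by apply: lt_le_trans lo; rewrite powR_gt0.
set u := ln eps^-1.
have uB : B < u by rewrite /u lnV ?posrE// ltrNr -(expRK (- B)) ltr_ln// posrE// expR_gt0.
have u0 : 0 < u by exact: lt_trans uB.
have um : m%:R * L <= u.
  rewrite mulr_natl -lnXn// ler_ln ?posrE ?invr_gt0//.
  by rewrite -[leLHS]invrK lef_pV2 ?posrE ?invr_gt0.
have um1 : u <= m.+1%:R * L.
  rewrite mulr_natl -lnXn// ler_ln ?posrE ?invr_gt0//.
  by rewrite -[leRHS]invrK lef_pV2 ?posrE ?invr_gt0// ltW.
have lnr_ge : s * (m%:R * L) <= ln r.
  by rewrite mulr_natl -lnXn// -ln_powR ler_ln// posrE powR_gt0.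
have lnr_le : ln r <= n%:R * ((M.+1 + m)%:R * L).
  rewrite mulr_natl mulr_natl -!lnXn// ?exprn_gt0//.
  by rewrite ler_ln ?posrE// ?exprn_gt0// addSnnS.
have eB : (n%:R * M.+1%:R + 2 * s) * L <= e * u.
  rewrite -ler_pdivrMl//.
  by apply: le_trans (ltW uB); rewrite /B [leLHS]mulrC lerDr ler01.
exists (ln r / u); first by rewrite lne_EFin.
have nML : 0 <= n%:R * M.+1%:R * L by rewrite !mulr_ge0// ltW.
have sL : 0 <= s * L by rewrite mulr_ge0// ltW.
have ge : (n%:R - e) * u <= ln r.
  apply: le_trans lnr_ge.
  have h1 : s * u <= s * (m.+1%:R * L) by rewrite ler_wpM2l.
  have h2 : (n%:R - e / 2) * u <= s * u by rewrite ler_wpM2r// ltW.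
  by move: h1; rewrite -natr1 => h1; lra.
have le : ln r <= (n%:R + e) * u.
  apply: le_trans lnr_le _.
  have h1 : n%:R * (m%:R * L) <= n%:R * u by rewrite ler_wpM2l// ltW.
  by rewrite natrD; lra.
by rewrite ler_distlC ler_pdivlMr// ler_pdivrMr// ge le.
Qed.

Lemma kakeya_minkowski_dim : has_minkowski_dim K n%:R.
Proof.
have near_ratio e : 0 < e -> \forall eps \near (0 : R)^'+, exists2 g : R,
    (lne (covering_number eps K) * ((ln eps^-1)^-1)%:E = g%:E)%E & `|n%:R - g| <= e.
  move=> /kakeya_box_ratio[d d0 dP]; near=> eps; apply: dP.
    by near: eps; exact: nbhs_right_gt.
  by near: eps; exact: nbhs_right_lt.
apply/fine_cvgP; split.
  by apply: filterS (near_ratio 1 ltr01) => eps [g -> _].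
apply/cvgrPdist_le => e /near_ratio; apply: filterS => eps [g].
by rewrite /comp => ->.
Unshelve. all: end_near. Qed.

End KakeyaDimension.

Theorem theorem1 (R : realType) (p : nat) (p_prime : prime p) (n : nat)
    (n_gt0 : (0 < n)%N) (K : set (padic_space R p_prime n)) :
  kakeya_set K ->
  hausdorff_dim K = (n%:R)%:E /\ has_minkowski_dim K n%:R.
Proof.
move=> kakeyaK.
by split; [exact: kakeya_hausdorff_dim|exact: kakeya_minkowski_dim].
Qed.
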